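(* Let $0<\alpha<1$, $\tau>0$, let $\lambda$ be a (real or complex) constant, let $f:[0,+\infty)\to\mathbb{R}$ and $\phi:[-\tau,0]\to\mathbb{R}$ be continuous, and set $y_0=\phi(0)$. Let $y$ be the solution of $$ {}^{C}\!D^{\alpha}_{0}y(t)=\lambda y(t-\tau)+f(t)\ (t>0),\qquad y(t)=\phi(t)\ (-\tau\le t\le0). $$ Let $p_\tau(t;\phi)$ be the inverse Laplace transform of $e^{-s\tau}P_\tau(s;\phi)$, where $$ P_\tau(s;\phi)=\phi(0)+s\int_{-\tau}^{0}e^{-sr}\phi(r)\,dr . $$ Then for every $t\ge0$ $$ y(t)=y_0+\sum_{k=0}^{\lfloor t/\tau\rfloor}\frac{\lambda^{k+1}}{\Gamma((k+1)\alpha+1)}\int_{0}^{t-k\tau}(t-k\tau-r)^{(k+1)\alpha}\,p_\tau(r;\phi)\,dr+\mathcal{J}_{0,\tau,\lambda}f(t). $$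
   Context: The Caputo derivative is ${}^{C}\!D^{\alpha}_{0}y=J_0^{1-\alpha}y'$, where $J_0^{\beta}u(t)=\frac{1}{\Gamma(\beta)}\int_0^t(t-r)^{\beta-1}u(r)\,dr$. A solution of the delay problem is a continuous function $y$ on $[-\tau,\infty)$ with $y=\phi$ on $[-\tau,0]$ satisfying the equation in its equivalent integral form $y(t)=\phi(0)+\frac{1}{\Gamma(\alpha)}\int_0^t(t-r)^{\alpha-1}\bigl[\lambda y(r-\tau)+f(r)\bigr]dr$ for $t\ge0$. The generalized integral is $$\mathcal{J}_{0,\tau,\lambda}f(t):=\sum_{k=0}^{\lfloor t/\tau\rfloor}\frac{\lambda^k}{\Gamma(\alpha k+\alpha)}\int_0^{t-k\tau}(t-k\tau-r)^{\alpha k+\alpha-1}f(r)\,dr .$$ The inverse Laplace transform $p_\tau(\cdot;\phi)$ is taken in the sense of distributions supported in $[0,\infty)$ (it may contain a Dirac mass at $0$, which is fully counted). The expression $\frac{1}{\Gamma((k+1)\alpha+1)}\int_0^{t-k\tau}(t-k\tau-r)^{(k+1)\alpha}p_\tau(r;\phi)\,dr$ denotes the value at $t$ of the convolution of $p_\tau(\cdot;\phi)$ with the function equal to $(t-k\tau)^{(k+1)\alpha}/\Gamma((k+1)\alpha+1)$ for $t\ge k\tau$ and $0$ for $t<k\tau$; this convolution is a continuous function. *)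

(* Defs.v *)
(* MathComp-Analysis; complex numbers are R[i] over a realType R. *)
From mathcomp Require Import all_boot all_order all_algebra.
From mathcomp Require Import all_classical all_reals all_analysis.
From mathcomp Require Export complex.
Import Order.TTheory GRing.Theory Num.Theory.
Import numFieldNormedType.Exports.

Set Implicit Arguments.
Unset Strict Implicit.
Unset Printing Implicit Defensive.

Local Open Scope classical_set_scope.
Local Open Scope ring_scope.
Local Open Scope complex_scope.

Section ComplexFunctions.
Context {R : realType}.
Implicit Types (g : R -> R) (u : R -> R[i]).

Definition cexp (z : R[i]) : R[i] :=
  (expR (complex.Re z) * cos (complex.Im z)) +i*
  (expR (complex.Re z) * sin (complex.Im z)).

(* Lebesgue integral over D of a complex-valued function of a real variable. *)
Definition cintegral (D : set R) u : R[i] :=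
  (\int[@lebesgue_measure R]_(x in D) complex.Re (u x)) +i*
  (\int[@lebesgue_measure R]_(x in D) complex.Im (u x)).

Definition ccontinuous_on (D : set R) u : Prop :=
  {within D, continuous (fun x => complex.Re (u x))} /\
  {within D, continuous (fun x => complex.Im (u x))}.

Definition cderiven (n : nat) u (x : R) : R[i] :=
  (derive1n n (fun t => complex.Re (u t)) x) +i*
  (derive1n n (fun t => complex.Im (u t)) x).

Definition smooth u : Prop := forall (n : nat) (x : R),
  derivable (derive1n n (fun t => complex.Re (u t))) x 1 /\
  derivable (derive1n n (fun t => complex.Im (u t))) x 1.

Definition eGamma (a : R) : R :=
  \int[@lebesgue_measure R]_(x in `]0, +oo[) (x `^ (a - 1) * expR (- x)).

(* Riemann-Liouville integral J_0^b u(t). *)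
Definition frac_integral (b : R) u (t : R) : R[i] :=
  ((eGamma b)^-1)%:C *
  cintegral `[0, t] (fun r => ((t - r) `^ (b - 1))%:C * u r).

End ComplexFunctions.

Section Distributions.
Context {R : realType}.
Implicit Types (psi theta : R -> R[i]) (p T : (R -> R[i]) -> R[i]).

Definition test_function psi : Prop :=
  smooth psi /\ exists K : R, forall x, K < `|x| -> psi x = 0.

Definition schwartz_function psi : Prop :=
  smooth psi /\ forall l n : nat, exists M : R, forall x,
    `|x| ^+ l * Normc.normc (cderiven n psi x) <= M.

Definition linear_on (D : set (R -> R[i])) p : Prop :=
  forall (a : R[i]) psi1 psi2, D psi1 -> D psi2 ->
    p (fun x => a * psi1 x + psi2 x) = a * p psi1 + p psi2.

(* Distributions on the real line. Only the values on test functions are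
   meaningful. B bounds the seminorms, so that the last line reads
   |p psi| <= C * max_(n <= m) sup |psi^(n)| for psi supported in [-K, K]. *)
Definition is_distribution p : Prop :=
  linear_on test_function p /\
  forall K : R, exists (m : nat) (C : R),
    forall psi, test_function psi -> (forall x, K < `|x| -> psi x = 0) ->
    forall B : R,
      (forall (n : nat) x, (n <= m)%N ->
         Normc.normc (cderiven n psi x) <= B) ->
      Normc.normc (p psi) <= C * B.

Definition is_tempered_distribution T : Prop :=
  linear_on schwartz_function T /\
  exists (m : nat) (C : R),
    forall psi, schwartz_function psi ->
    forall B : R,
      (forall (l n : nat) x, (l <= m)%N -> (n <= m)%N ->
         `|x| ^+ l * Normc.normc (cderiven n psi x) <= B) ->
      Normc.normc (T psi) <= C * B.

Definition eq_near_nonneg psi theta : Prop :=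
  exists2 e : R, 0 < e & forall x, - e < x -> psi x = theta x.

Definition supported_nonneg p : Prop :=
  forall psi, test_function psi -> eq_near_nonneg psi (fun=> 0) -> p psi = 0.

(* F is the Laplace transform of p on the half-plane Re s > s0: for s1 > s0,
   e^{-s1 t} p extends to a tempered distribution T, and for Re s > s1,
   F s = <T, e^{-(s - s1) t}>. As T is supported in [0, +oo[, this pairing is
   the value of T at any Schwartz function equal to e^{-(s - s1) t} near
   [0, +oo[. *)
Definition laplace_transform_on p (s0 : R) (F : R[i] -> R[i]) : Prop :=
  forall s1 : R, s0 < s1 ->
  exists T, [/\ is_tempered_distribution T,
    forall psi, test_function psi ->
      T psi = p (fun t => (expR (- (s1 * t)))%:C * psi t) &
    forall s : R[i], s1 < complex.Re s ->
      exists theta, [/\ schwartz_function theta,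
        eq_near_nonneg theta (fun t => cexp (- (s - s1%:C) * t%:C)) &
        T theta = F s]].

Definition inverse_laplace_transform (F : R[i] -> R[i]) p : Prop :=
  [/\ is_distribution p, supported_nonneg p &
    exists s0 : R, laplace_transform_on p s0 F].

(* For p and g supported in [0, +oo[, the continuous function c is the
   convolution p * g: for every test function psi,
   \int c psi = <p_r, \int g(u) psi(r + u) du>. The inner integral vanishes for
   large r, so it agrees near [0, +oo[ with a test function theta, and its
   pairing with p is p theta. *)
Definition continuous_convolution p (g : R -> R) (c : R -> R[i]) : Prop :=
  ccontinuous_on setT c /\
  forall psi, test_function psi ->
    exists theta, [/\ test_function theta,
      eq_near_nonneg theta
        (fun r => cintegral setT (fun u => (g u)%:C * psi (r + u))) &
      p theta = cintegral setT (fun t => c t * psi t)].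

End Distributions.

Section DelayProblem.
Context {R : realType}.
Implicit Types (alpha tau : R) (lambda : R[i]) (f phi : R -> R).

Definition delay_solution alpha tau lambda f phi (y : R -> R[i]) : Prop :=
  [/\ ccontinuous_on `[- tau, +oo[ y,
    forall t, - tau <= t <= 0 -> y t = (phi t)%:C &
    forall t, 0 <= t -> y t = (phi 0)%:C +
      frac_integral alpha (fun r => lambda * y (r - tau) + (f r)%:C) t].

Definition P_tau tau phi (s : R[i]) : R[i] :=
  (phi 0)%:C +
  s * cintegral `[- tau, 0] (fun r => cexp (- s * r%:C) * (phi r)%:C).

Definition generalized_integral alpha tau lambda f (t : R) : R[i] :=
  \sum_(0 <= k < (Num.truncn (t / tau)).+1)
    lambda ^+ k *
    frac_integral (alpha * k%:R + alpha) (fun r => (f r)%:C) (t - k%:R * tau).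

(* The real power x `^ a equals 1 for x < 0, hence the explicit test. *)
Definition delayed_power alpha tau (k : nat) (t : R) : R :=
  if k%:R * tau <= t then
    (t - k%:R * tau) `^ (k.+1%:R * alpha) / eGamma (k.+1%:R * alpha + 1)
  else 0.

End DelayProblem.

(* Main.v *)
(* Let Psi r = phi (r - tau) for 0 <= r <= tau and Psi r = phi 0 for r >= tau.
   For t >= 0 the equation for v = y - phi 0, extended by 0 to the negative
   axis, reads v(t) = lambda J^alpha v(t - tau) + J^alpha(lambda Psi + f)(t).
   Iterating it on the steps [N tau, (N + 1) tau], with J^a J^b = J^(a + b)
   (Euler's identity between Beta and Gamma), gives
     y(t) = phi 0 + \sum_k lambda^k J^((k + 1) alpha)(lambda Psi + f)(t - k tau).
   It remains to recognize J^((k + 1) alpha) Psi(t - k tau) as the convolution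
   of p with the k-th delayed power, which holds if p is the distributional
   derivative of Psi extended by 0 to the negative axis (this creates the Dirac
   mass at 0), by Fubini and an integration by parts.  An integration by parts
   shows that this derivative has the Laplace transform of p.  Laplace
   transforms are injective on distributions supported in [0, +oo[: the
   transforms at the points s1 + 1, s1 + 2, ... already give the pairings of
   e^(-s1 t) p with all sums of the exponentials e^(-n t), n >= 1, and these
   sums approximate a test function and its first m derivatives on [-1, +oo[
   with an error at most e * e^(-t). *)

(* Two obstacles shape the uniqueness argument. The tempered extension [T] of [e^(-s1 t) p] is known
   at exponentials only through unspecified Schwartz functions equal to them near [[0, +oo[]; so [T]
   must be shown to kill every Schwartz function vanishing on some []-e, +oo[], although the support
   condition speaks of test functions only. And [T] is continuous for seminorms with powers of [x]
   and several derivatives: this is why the approximation by exponentials is weighted by [e^(-t)],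
   is made on the highest derivative and is then integrated from +oo. As the exponentials grow at
   -oo, they are multiplied by a smooth cutoff, 0 up to -1 and 1 from -1/2 on; this is where the
   point -1 comes from. The evaluation points are real, so real and imaginary parts of test
   functions can be treated separately. Since [phi] is merely continuous, the derivative of [Psi] is
   never formed but represented by [history_pairing]; kernels cut at 0 turn all the integrals into
   convolutions over the line. *)
Require Import Defs.
From mathcomp Require Import all_boot all_order all_algebra.
From mathcomp Require Import all_classical all_reals all_analysis.
From mathcomp Require Import measurable_realfun real_interval.
From mathcomp Require Import ring lra.
Import Order.TTheory GRing.Theory Num.Theory.
Import numFieldNormedType.Exports.

Set Implicit Arguments.
Unset Strict Implicit.
Unset Printing Implicit Defensive.

Local Open Scope classical_set_scope.
Local Open Scope ring_scope.
Local Open Scope complex_scope.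

(** * Lebesgue integrals under translation, reflection and scaling *)

Section AffineInvariance.
Context {R : realType}.
Local Notation mu := (@lebesgue_measure R).
Implicit Types (f : R -> \bar R) (c : R).
Local Open Scope ereal_scope.

(** The image of Lebesgue measure under the translation agrees with Lebesgue measure on the
    intervals []a, b]], hence everywhere; scaling is treated in the same way below. *)
Lemma ge0_integral_shift f c : measurable_fun setT f -> (forall x, 0 <= f x) ->
  \int[mu]_x f (x + c)%R = \int[mu]_x f x.
Proof.
move=> mf f0.
have mc : measurable_fun setT (fun x : R => (x + c)%R : measurableTypeR R).
  exact: measurable_funD.
rewrite -[LHS](_ : \int[pushforward mu (fun x : R => (x + c)%R : measurableTypeR R)]_x f x = _);
    last by rewrite ge0_integral_pushforward// => x _; exact: f0.
apply: eq_measure_integral => //= A mA _; apply/esym.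
apply: lebesgue_measure_unique => //= _ [[a b]] _ <-.
rewrite /pushforward (_ : _ @^-1` _ = `](a - c)%R, (b - c)%R]%classic).
  by rewrite !lebesgue_measure_itv/= !lte_fin ltrD2r; case: ifP => // _;
     congr (_%:E); ring.
by apply/seteqP; split => x /=; rewrite !in_itv/= ltrBlDr lerBrDr.
Qed.

Lemma ge0_integral_opp f : measurable_fun setT f -> (forall x, 0 <= f x) ->
  \int[mu]_x f (- x)%R = \int[mu]_x f x.
Proof.
move=> mf f0.
rewrite -[LHS](_ : \int[pushforward mu (-%R : _ -> measurableTypeR R)]_x f x = _);
    last by rewrite ge0_integral_pushforward// => x _; exact: f0.
by apply: eq_measure_integral => //= A mA _; exact: lebesgue_measureN.
Qed.

Lemma ge0_integral_scale f c : (0 < c)%R -> measurable_fun setT f ->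
  (forall x, 0 <= f x) -> \int[mu]_x f x = c%:E * \int[mu]_x f (c * x)%R.
Proof.
move=> c0 mf f0.
have mc : measurable_fun setT (fun x : R => (c * x)%R : measurableTypeR R).
  exact: mulrl_measurable.
rewrite (_ : \int[mu]_x f (c * x)%R =
    \int[pushforward mu (fun x : R => (c * x)%R : measurableTypeR R)]_x f x);
    last by rewrite ge0_integral_pushforward// => x _; exact: f0.
rewrite (_ : c%:E = (NngNum (ltW c0))%:num%:E)// -ge0_integral_mscale//.
apply: eq_measure_integral => //= A mA _.
apply: lebesgue_measure_unique => //= _ [[a b]] _ <-.
rewrite /mscale/= /pushforward (_ : _ @^-1` _ = `](a / c)%R, (b / c)%R]%classic).
  rewrite !lebesgue_measure_itv/= !lte_fin ltr_pM2r ?invr_gt0//.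
  case: ifP => // _; last by rewrite mule0.
  by rewrite -EFinB -EFinM; congr (_%:E); field; rewrite gt_eqF.
by apply/seteqP; split => x /=; rewrite !in_itv/= ltr_pdivrMr// ler_pdivlMr//
  (mulrC x).
Qed.

Local Open Scope ring_scope.

(** Positive and negative parts are moved separately, so the two sides agree even when [Rintegral]
    takes a default value. *)
Lemma Rintegral_shift (f : R -> R) c : measurable_fun setT f ->
  \int[mu]_x f (x + c) = \int[mu]_x f x.
Proof.
move=> mf; congr fine; rewrite integralE [RHS]integralE.
have mfE : measurable_fun setT (EFin \o f) by exact/measurable_EFinP.
congr (_ - _)%E; rewrite -[RHS](@ge0_integral_shift _ c)//.
- by apply: eq_integral => x _; rewrite !funeposE.
- exact: measurable_funepos.
- by apply: eq_integral => x _; rewrite !funenegE.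
- exact: measurable_funeneg.
Qed.

Lemma Rintegral_opp (f : R -> R) : measurable_fun setT f ->
  \int[mu]_x f (- x) = \int[mu]_x f x.
Proof.
move=> mf; congr fine; rewrite integralE [RHS]integralE.
have mfE : measurable_fun setT (EFin \o f) by exact/measurable_EFinP.
congr (_ - _)%E; rewrite -[RHS](@ge0_integral_opp _)//.
- by apply: eq_integral => x _; rewrite !funeposE.
- exact: measurable_funepos.
- by apply: eq_integral => x _; rewrite !funenegE.
- exact: measurable_funeneg.
Qed.

End AffineInvariance.

(** * Truncated powers and the Gamma integral *)

Section TruncatedPower.
Context {R : realType}.
Local Notation mu := (@lebesgue_measure R).
Implicit Types (a b x K : R).

(** The cut at 0 turns integrals over [[0, t]] into convolutions over the line, where translations
    and Fubini require no care about domains. *)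
Definition tpow a x : R := if 0 < x then x `^ (a - 1) else 0.

Lemma tpow_ge0 a x : 0 <= tpow a x.
Proof. by rewrite /tpow; case: ifP => // _; exact: powR_ge0. Qed.

Lemma tpow_le0 a x : x <= 0 -> tpow a x = 0.
Proof. by move=> x0; rewrite /tpow ltNge x0. Qed.

Lemma tpow_gt0 a x : 0 < x -> tpow a x = x `^ (a - 1).
Proof. by move=> x0; rewrite /tpow x0. Qed.

Lemma measurable_tpow a : measurable_fun setT (tpow a).
Proof.
by apply: measurable_fun_ifT => //; exact: measurable_fun_ltr.
Qed.

(** For [a < 1] the integrand is unbounded at 0: the fundamental theorem bounds the integral over
    [[1/(n+1), K]] by [K^a / a] uniformly in [n], and monotone convergence concludes. *)
Lemma integral_tpow_ltoo a K : 0 < a ->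
  (\int[mu]_(x in `]-oo, K]) (tpow a x)%:E < +oo)%E.
Proof.
move=> a0; have mE : measurable_fun setT (EFin \o tpow a).
  by apply/measurable_EFinP; exact: measurable_tpow.
have [K0|K0] := leP K 0.
  rewrite integral0_eq// => x /=; rewrite in_itv/= => xK.
  by rewrite tpow_le0// (le_trans xK).
have -> : (\int[mu]_(x in `]-oo, K]) (tpow a x)%:E)%E =
          (\int[mu]_(x in `]0%R, K]) (tpow a x)%:E)%E.
  rewrite integral_mkcond [RHS]integral_mkcond; apply: eq_integral => x _.
  rewrite !patchE; case: ifPn; case: ifPn => //.
  - rewrite !notin_setE !inE/= !in_itv/= => /negP + xK.
    by rewrite xK andbT -leNgt => x0; rewrite tpow_le0.
  - by rewrite !inE !notin_setE/= !in_itv/= => /andP[_ ->].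
apply: (@le_lt_trans _ _ (K `^ a / a)%:E); last exact: ltry.
rewrite itv_open_bnd_bigcup.
pose F n : set R := [set` `[0 + n.+1%:R^-1, K]].
have ndF : nondecreasing_seq F.
  apply/nondecreasing_seqP => n; rewrite /F; apply/subsetPset.
  apply: subset_itvr; rewrite bnd_simp !add0r lef_pV2 ?posrE ?ltr0n//.
  by rewrite ler_nat.
have mF i : measurable (F i) by exact: measurable_itv.
have mFE i : measurable_fun (F i) (EFin \o tpow a) by exact: measurable_funS mE.
have tp0 (i : nat) x : F i x -> (0 <= (EFin \o tpow a) x)%E.
  by move=> _; rewrite lee_fin tpow_ge0.
have : (\int[mu]_(x in F i) (tpow a x)%:E @[i --> \oo] -->
    \int[mu]_(x in \bigcup_i F i) (tpow a x)%:E)%E.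
  exact: ge0_nondecreasing_set_cvg_integral.
move=> /cvg_lim <-//; apply: lime_le.
  apply: ereal_nondecreasing_is_cvgn.
  exact: ge0_nondecreasing_set_nondecreasing_integral.
apply: nearW => n; rewrite /F add0r.
have n0 : 0 < n.+1%:R^-1 :> R by rewrite invr_gt0.
have [Kn|nK] := leP K n.+1%:R^-1.
  rewrite (_ : [set` _] = [set` `[n.+1%:R^-1, K]])// .
  apply: (@le_trans _ _ 0%E); last by rewrite lee_fin divr_ge0// ?powR_ge0// ltW.
  rewrite null_set_integral//=; first exact: measurable_funS mE.
  rewrite lebesgue_measure_itv/= lte_fin.
  by case: ltP => // h; have := le_lt_trans Kn h; rewrite ltxx.
have isd x : 0 < x -> is_derive x 1 (fun x => x `^ a / a) (x `^ (a - 1)).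
  move=> x0; have -> : (fun x => x `^ a / a) = a^-1 \*: ((@powR R) ^~ a).
    by apply/funext => z /=; rewrite mulrC.
  have dx := is_derive1_powR a x0.
  apply: (is_derive_eq (is_deriveZ a^-1 dx)).
  by rewrite /GRing.scale/= mulrA mulVf ?mul1r// gt_eqF.
have -> : (\int[mu]_(x in `[n.+1%:R^-1%R, K]) (tpow a x)%:E)%E =
          (\int[mu]_(x in `[n.+1%:R^-1%R, K]) (x `^ (a - 1))%:E)%E.
  apply: eq_integral => x; rewrite inE/= in_itv/= => /andP[nx _].
  by rewrite tpow_gt0// (lt_le_trans n0).
have cpow b : {within `[n.+1%:R^-1, K], continuous ((@powR R) ^~ b)}.
  apply: derivable_within_continuous => x; rewrite in_itv/= => /andP[nx _].
  by apply: derivable_powR; rewrite in_itv/= andbT (lt_le_trans n0).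
have cF : {within `[n.+1%:R^-1, K], continuous (fun x => x `^ a / a)}.
  apply: derivable_within_continuous => x; rewrite in_itv/= => /andP[nx _].
  by have [] := isd x (lt_le_trans n0 nx).
rewrite (@continuous_FTC2 _ _ (fun x => x `^ a / a))//.
- rewrite -EFinB lee_fin gerBl divr_ge0// ?powR_ge0// ltW//.
- have /(continuous_within_itvP _ nK)[_ c1 c2] := cF.
  split => // x; rewrite in_itv/= => /andP[nx _].
  by have [] := isd x (lt_trans n0 nx).
- move=> x; rewrite in_itv/= => /andP[nx _].
  by rewrite derive1E; have [_ ->] := isd x (lt_trans n0 nx).
Qed.

Definition gamma_kernel a x : R := tpow a x * expR (- x).

Lemma gamma_kernel_ge0 a x : 0 <= gamma_kernel a x.
Proof. by rewrite mulr_ge0 ?tpow_ge0 ?expR_ge0. Qed.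

Lemma measurable_gamma_kernel a : measurable_fun setT (gamma_kernel a).
Proof.
apply: measurable_funM; first exact: measurable_tpow.
by apply: measurableT_comp => //; exact: measurable_expR.
Qed.

(** An integrable majorant. Up to 1 the exponential is at most 1; beyond 1, half of the exponential
    absorbs the power, as [x^N <= N! 2^N e^(x/2)] with [N > |a|], and the other half is twice the
    exponential density of rate 1/2. *)
Lemma gamma_kernel_le a : exists2 C, 0 <= C & forall x,
  gamma_kernel a x <= (tpow a \_ `]-oo, 1]) x + C * exponential_pdf (2^-1) x.
Proof.
pose N := (Num.truncn `|a|).+1.
pose C : R := 2 * (N`!%:R * 2 ^+ N).
have hC : 0 <= C by rewrite /C !mulr_ge0// exprn_ge0.
exists C => // x.
have pdf0 : 0 <= C * exponential_pdf 2^-1 x.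
  by rewrite mulr_ge0// exponential_pdf_ge0.
rewrite patchE; case: ifPn; rewrite ?inE ?notin_setE/= in_itv/= => x1.
  apply: ler_wpDr => //; rewrite /gamma_kernel.
  have [x0|x0] := leP x 0; first by rewrite tpow_le0 ?mul0r.
  by rewrite ler_piMr ?tpow_ge0// -expR0 ler_expR oppr_le0 ltW.
move/negP : x1; rewrite -ltNge => x1; have x0 := lt_trans ltr01 x1.
rewrite add0r exponential_pdfE; last exact: ltW.
rewrite /gamma_kernel tpow_gt0//.
have -> : - x = - (x / 2) + - (x / 2) by field.
rewrite expRD mulrA [leRHS](_ : _ =
    N`!%:R * 2 ^+ N * expR (- (x / 2))); last first.
  by rewrite /C (_ : - 2^-1 * x = - (x / 2)); last ring; field.
apply: ler_wpM2r; first exact: expR_ge0.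
rewrite expRN ler_pdivrMr ?expR_gt0//.
have : x `^ (a - 1) <= x ^+ N.
  rewrite -powR_mulrn; last exact: ltW.
  apply: ler_powR; first exact: ltW.
  have := ler_norm a; have : `|a| < N%:R by exact: truncnS_gt.
  lra.
move=> /le_trans; apply.
have := @expR_ge1Dxn R (x / 2) N.-1 (ltW (divr_gt0 x0 (ltr0Sn _ 1))).
rewrite [N.-1.+1]/= -/N => h.
have : (x / 2) ^+ N / N`!%:R <= expR (x / 2).
  by apply: le_trans h; rewrite lerDr.
rewrite ler_pdivrMr ?ltr0n ?fact_gt0// exprMn exprVn ler_pdivrMr ?exprn_gt0//.
by move=> /le_trans; apply; rewrite le_eqVlt; apply/orP; left; apply/eqP; ring.
Qed.

Lemma integral_gamma_kernel_ltoo a : 0 < a ->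
  (\int[mu]_x (gamma_kernel a x)%:E < +oo)%E.
Proof.
move=> a0; have [C C0 hC] := gamma_kernel_le a.
have m1 : measurable_fun setT (tpow a \_ `]-oo, 1]).
  apply/(measurable_restrictT (tpow a)) => //.
  by apply: measurable_funTS; exact: measurable_tpow.
have m2 : measurable_fun setT (fun x => C * exponential_pdf 2^-1 x).
  by apply: measurable_funM => //; exact: measurable_exponential_pdf.
apply: (@le_lt_trans _ _ (\int[mu]_x (((tpow a \_ `]-oo, 1]) x)%:E +
   (C * exponential_pdf 2^-1 x)%:E))%E).
  apply: ge0_le_integral => //=.
  - by move=> x _; rewrite lee_fin gamma_kernel_ge0.
  - by apply/measurable_EFinP; exact: measurable_gamma_kernel.
  - by apply: emeasurable_funD; apply/measurable_EFinP.
  - by move=> x _; rewrite -EFinD lee_fin.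
rewrite ge0_integralD//=; last 4 first.
- by move=> x _; rewrite lee_fin patchE; case: ifP => // _; exact: tpow_ge0.
- by apply/measurable_EFinP.
- by move=> x _; rewrite lee_fin mulr_ge0// exponential_pdf_ge0.
- by apply/measurable_EFinP.
apply: lte_add_pinfty.
  have := integral_tpow_ltoo 1 a0; rewrite integral_mkcond.
  by under eq_integral do rewrite restrict_EFin.
under eq_integral do rewrite EFinM.
rewrite ge0_integralZl_EFin//.
- by rewrite integral_exponential_pdf ?mule1 ?ltry.
- by move=> x _; rewrite lee_fin exponential_pdf_ge0.
- by apply/measurable_EFinP; exact: measurable_exponential_pdf.
Qed.

Lemma eGammaE a : 0 < a ->
  (\int[mu]_x (gamma_kernel a x)%:E)%E = (eGamma a)%:E.
Proof.
move=> a0; have -> : eGamma a = \int[mu]_x gamma_kernel a x.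
  rewrite /eGamma Rintegral_mkcond; apply: eq_Rintegral => x _.
  rewrite patchE; case: ifPn.
    by rewrite inE/= in_itv/= andbT => x0; rewrite /gamma_kernel tpow_gt0.
  rewrite notin_setE/= in_itv/= andbT => /negP; rewrite -leNgt => x0.
  by rewrite /gamma_kernel tpow_le0 ?mul0r.
rewrite /Rintegral fineK// ge0_fin_numE ?integral_gamma_kernel_ltoo//.
by apply: integral_ge0 => x _; rewrite lee_fin gamma_kernel_ge0.
Qed.

Lemma eGamma_gt0 a : 0 < a -> 0 < eGamma a.
Proof.
move=> a0; rewrite -lte_fin -eGammaE//.
(* On [[1, 2]], [x^(a - 1) >= x^(-1) >= 1/2] and [e^(-x) >= e^(-2)]. *)
have c0 : 0 < (2^-1 * expR (- 2) : R) by rewrite mulr_gt0 ?invr_gt0// expR_gt0.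
apply: (@lt_le_trans _ _ (\int[mu]_(x in `[1%R, 2%R]) (2^-1 * expR (- 2))%:E)%E).
  rewrite integral_cst//= lebesgue_measure_itv/= lte_fin ltr1n/=.
  rewrite -EFinB -EFinM lte_fin mulr_gt0//; lra.
apply: (@le_trans _ _ (\int[mu]_(x in `[1%R, 2%R]) (gamma_kernel a x)%:E)%E).
  apply: ge0_le_integral => //=.
    apply/measurable_EFinP; apply: measurable_funTS.
    exact: measurable_gamma_kernel.
  move=> x; rewrite in_itv/= => /andP[x1 x2]; rewrite lee_fin.
  have x0 := lt_le_trans ltr01 x1.
  rewrite /gamma_kernel tpow_gt0//; apply: ler_pM.
  - by rewrite invr_ge0.
  - exact: expR_ge0.
  - apply: (@le_trans _ _ (x `^ (-1))).
      by rewrite powR_inv1 ?(ltW x0)// lef_pV2 ?posrE.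
    by apply: ler_powR => //; rewrite lerBrDr addNr ltW.
  - by rewrite ler_expR lerN2.
apply: ge0_subset_integral => //=.
- by apply/measurable_EFinP; exact: measurable_gamma_kernel.
- by move=> x _; rewrite lee_fin gamma_kernel_ge0.
Qed.

Lemma eGamma1 : eGamma 1 = 1 :> R.
Proof.
transitivity (\int[mu]_x exponential_pdf 1 x); last first.
  by rewrite /Rintegral integral_exponential_pdf.
rewrite -[RHS]Rintegral_mkcond -Rintegral_itv_obnd_cbnd.
  apply: eq_Rintegral => x; rewrite inE/= in_itv/= andbT => x0.
  by rewrite subrr powRr0 mul1r !mulN1r mul1r.
have := integrable_exponential_pdf (@ltr01 R).
move=> ie; have : mu.-integrable `]0, +oo[ (EFin \o exponential_pdf 1).
  exact: (integrableS _ _ _ ie).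
apply: eq_integrable => //= x; rewrite inE/= in_itv/= andbT => x0.
by rewrite exponential_pdfE ?(ltW x0)// mul1r mulN1r subrr powRr0 mul1r.
Qed.

End TruncatedPower.

(** * Euler's identity and the convolution of fractional kernels *)

Section BetaIntegral.
Context {R : realType}.
Local Notation mu := (@lebesgue_measure R).
Implicit Types (a b c t x y : R).

Lemma tpowZ a c x : 0 < c -> tpow a (c * x) = c `^ (a - 1) * tpow a x.
Proof.
move=> c0; rewrite /tpow pmulr_rgt0//; case: ifP => x0; last by rewrite mulr0.
by rewrite powRM// ltW.
Qed.

Lemma measurable_tpow_conv a b t :
  measurable_fun setT (fun r : R => tpow a (t - r) * tpow b r).
Proof.
apply: measurable_funM; last exact: measurable_tpow.
apply: (measurableT_comp (measurable_tpow a)).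
exact: measurable_funB.
Qed.

Local Open Scope ereal_scope.

(** Substituting [t r] for [r] collects the powers of [t]: 1 from the measure, [a - 1] and [b - 1]
    from the kernels. *)
Lemma tpow_conv_scale a b t : (0 < t)%R ->
  \int[mu]_r (tpow a (t - r) * tpow b r)%:E =
  (tpow (a + b) t)%:E * \int[mu]_r (tpow a (1 - r) * tpow b r)%:E.
Proof.
move=> t0; pose g (r : R) := (tpow a (t - r) * tpow b r)%:E.
have mg : measurable_fun setT g.
  by apply/measurable_EFinP; exact: measurable_tpow_conv.
have g0 r : 0 <= g r by rewrite lee_fin mulr_ge0// tpow_ge0.
rewrite [LHS](ge0_integral_scale t0 mg g0) /g.
have -> : \int[mu]_r (tpow a (t - t * r) * tpow b (t * r))%:E =
    \int[mu]_r ((t `^ (a - 1) * t `^ (b - 1))%:E * (tpow a (1 - r) * tpow b r)%:E).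
  apply: eq_integral => r _.
  have -> : (t - t * r = t * (1 - r))%R by ring.
  by rewrite !tpowZ// -EFinM; congr (_%:E); ring.
rewrite ge0_integralZl_EFin//.
- rewrite muleA -EFinM; congr (_%:E * _).
  have nz (u v : R) : ((u + v == 0) ==> (t != 0))%R.
    by rewrite (gt_eqF t0) implybT.
  rewrite tpow_gt0// -{1}(powRr1 (ltW t0)) -(powRD (nz _ _)) -(powRD (nz _ _)).
  by have -> : (1 + (a - 1 + (b - 1)) = a + b - 1)%R by ring.
- by move=> r _; rewrite lee_fin mulr_ge0// tpow_ge0.
- by apply/measurable_EFinP; exact: measurable_tpow_conv.
- by rewrite mulr_ge0// powR_ge0.
Qed.

Lemma tpow_conv_le0 a b t : (t <= 0)%R ->
  \int[mu]_r (tpow a (t - r) * tpow b r)%:E = 0.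
Proof.
move=> t0; apply: integral0_eq => r _.
have [r0|r0] := leP r 0%R; first by rewrite (tpow_le0 b r0) mulr0.
by rewrite (tpow_le0 a) ?mul0r//; lra.
Qed.

(* Gamma(a) Gamma(b) is the integral over the line of the convolution of the
   kernels x^(a - 1) e^(-x) and x^(b - 1) e^(-x); by scaling, this convolution
   at x is x^(a + b - 1) e^(-x) times the Beta integral. *)
Lemma beta_gamma a b : (0 < a)%R -> (0 < b)%R ->
  (eGamma a * eGamma b)%:E =
  (eGamma (a + b))%:E * \int[mu]_r (tpow a (1 - r) * tpow b r)%:E.
Proof.
move=> a0 b0; have ab0 : (0 < a + b)%R by rewrite addr_gt0.
have gk0 c x : (0 <= gamma_kernel c x)%R by exact: gamma_kernel_ge0.
have mgk c : measurable_fun setT (EFin \o gamma_kernel c).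
  by apply/measurable_EFinP; exact: measurable_gamma_kernel.
have tp0 r : 0 <= (tpow a (1 - r) * tpow b r)%:E.
  by rewrite lee_fin mulr_ge0// tpow_ge0.
pose f (z : R * R) : \bar R := (gamma_kernel b z.1 * gamma_kernel a (z.2 - z.1))%:E.
have mf : measurable_fun setT f.
  apply/measurable_EFinP; apply: measurable_funM.
    by apply: measurableT_comp; [exact: measurable_gamma_kernel|].
  apply: measurableT_comp; first exact: measurable_gamma_kernel.
  exact: measurable_funB.
have f0 z : 0 <= f z by rewrite lee_fin mulr_ge0.
transitivity (\int[mu]_y \int[mu]_x f (y, x)).
  rewrite mulrC EFinM -(eGammaE b0) muleC -ge0_integralZl//; last 3 first.
  - exact: mgk.
  - by move=> y _; rewrite lee_fin.
  - by rewrite lee_fin ltW// eGamma_gt0.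
  apply: eq_integral => y _; rewrite /f/=.
  under [RHS]eq_integral do rewrite EFinM.
  rewrite [RHS]ge0_integralZl_EFin//; last 2 first.
  - by move=> x _; rewrite lee_fin.
  - apply/measurable_EFinP; apply: measurableT_comp.
      exact: measurable_gamma_kernel.
    exact: measurable_funB.
  rewrite muleC; congr (_ * _).
  rewrite -(eGammaE a0); apply/esym.
  by apply: (@ge0_integral_shift R (EFin \o gamma_kernel a) (- y)%R) => // x;
    rewrite lee_fin.
rewrite (@fubini_tonelli _ _ _ _ _ mu mu f)//.
rewrite -(eGammaE ab0) -ge0_integralZr//; last 3 first.
- exact: mgk.
- by move=> x _; rewrite lee_fin.
- exact: integral_ge0.
apply: eq_integral => x _.
transitivity ((expR (- x))%:E * \int[mu]_r (tpow a (x - r) * tpow b r)%:E).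
  rewrite -ge0_integralZl//; last 2 first.
  - by apply/measurable_EFinP; exact: measurable_tpow_conv.
  - by move=> r _; rewrite lee_fin mulr_ge0// tpow_ge0.
  apply: eq_integral => r _; rewrite /f/= -EFinM; congr (_%:E).
  rewrite /gamma_kernel; have -> : (expR (- x) = expR (- r) * expR (- (x - r)))%R.
    by rewrite -expRD; congr expR; ring.
  by ring.
have [x0|x0] := leP x 0%R.
  by rewrite tpow_conv_le0// /gamma_kernel tpow_le0// mul0r mule0 mul0e.
by rewrite tpow_conv_scale// muleA -EFinM mulrC.
Qed.

(** Convolution with this kernel is [J^a]; for [a = 1] it is the Heaviside function. *)
Definition frac_kernel a x : R := (tpow a x / eGamma a)%R.

Lemma frac_kernel_conv a b t : (0 < a)%R -> (0 < b)%R ->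
  \int[mu]_r (frac_kernel a (t - r) * frac_kernel b r)%:E =
  (frac_kernel (a + b) t)%:E.
Proof.
move=> a0 b0; have ab0 : (0 < a + b)%R by rewrite addr_gt0.
have ga := eGamma_gt0 a0; have gb := eGamma_gt0 b0; have gab := eGamma_gt0 ab0.
have -> : \int[mu]_r (frac_kernel a (t - r) * frac_kernel b r)%:E =
   \int[mu]_r (((eGamma a * eGamma b)^-1)%:E * (tpow a (t - r) * tpow b r)%:E).
  apply: eq_integral => r _; rewrite -EFinM; congr (_%:E).
  by rewrite /frac_kernel invfM; ring.
rewrite ge0_integralZl_EFin//; last 3 first.
- by move=> r _; rewrite lee_fin mulr_ge0// tpow_ge0.
- by apply/measurable_EFinP; exact: measurable_tpow_conv.
- by rewrite invr_ge0 mulr_ge0// ltW.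
have [t0|t0] := leP t 0%R.
  by rewrite tpow_conv_le0// mule0 /frac_kernel tpow_le0// mul0r.
rewrite tpow_conv_scale// /frac_kernel.
have /(congr1 (fun z => (((eGamma a * eGamma b)^-1)%:E * (eGamma (a + b))^-1%:E * z))) := beta_gamma a0 b0.
rewrite muleAC -!EFinM mulVf ?mul1r; last by rewrite mulf_eq0 !gt_eqF.
move=> e; rewrite [RHS]EFinM e !muleA -!EFinM; congr (_%:E * _).
by field; rewrite !gt_eqF.
Qed.

End BetaIntegral.

(** * Riemann-Liouville integrals as convolutions over the line *)

Section RiemannLiouville.
Context {R : realType}.
Local Notation mu := (@lebesgue_measure R).
Implicit Types (a b c t x y : R) (h H : R -> R).

Lemma Rintegral_reflect h t : measurable_fun setT h ->
  \int[mu]_x h (t - x) = \int[mu]_x h x.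
Proof.
move=> mh; rewrite -[RHS](Rintegral_shift t mh).
have mt : measurable_fun setT (fun x : R => h (x + t)).
  by apply: measurableT_comp => //; exact: measurable_funD.
rewrite -[RHS](Rintegral_opp mt).
by apply: eq_Rintegral => x _; rewrite addrC.
Qed.

Lemma ge0_integral_reflect (f : R -> \bar R) t : measurable_fun setT f ->
  (forall x, 0 <= f x)%E -> (\int[mu]_x f (t - x)%R = \int[mu]_x f x)%E.
Proof.
move=> mf f0; rewrite -[RHS](ge0_integral_shift t mf f0).
have mt : measurable_fun setT (fun x : R => f (x + t)).
  by apply: measurableT_comp => //; exact: measurable_funD.
rewrite -[RHS](ge0_integral_opp mt)//.
by apply: eq_integral => x _; rewrite addrC.
Qed.

Lemma integrable_reflect h t : mu.-integrable setT (EFin \o h) ->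
  mu.-integrable setT (EFin \o (fun x => h (t - x))).
Proof.
move=> /integrableP[mh ih]; apply/integrableP; split.
  by apply: (measurableT_comp mh); exact: measurable_funB.
pose f (x : R) := `|(h x)%:E|%E.
have mf : measurable_fun setT f by exact: measurableT_comp.
have f0 x : (0 <= f x)%E by exact: abse_ge0.
by have := ge0_integral_reflect t mf f0; rewrite /f/= => ->.
Qed.

Lemma frac_kernel_ge0 a x : 0 < a -> 0 <= frac_kernel a x.
Proof. by move=> a0; rewrite divr_ge0 ?tpow_ge0// ltW// eGamma_gt0. Qed.

Lemma frac_kernel_le0 a x : x <= 0 -> frac_kernel a x = 0.
Proof. by move=> x0; rewrite /frac_kernel tpow_le0// mul0r. Qed.

Lemma measurable_frac_kernel a : measurable_fun setT (@frac_kernel R a).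
Proof.
apply: (@measurable_funM _ _ _ _ (tpow a) (fun=> (eGamma a)^-1)).
  exact: measurable_tpow.
exact: measurable_cst.
Qed.

(** Makes [RLint a h t] converge for all [t]: the integrand lives on []0, t[], where [h] is bounded
    and the kernel integrable. A jump at 0 is allowed, as [pos] produces one. *)
Definition causal h := [/\ measurable_fun setT h,
  forall x, x <= 0 -> h x = 0 &
  forall K, exists M, forall x, x <= K -> `|h x| <= M].

Lemma integrable_frac_kernel a K : 0 < a ->
  mu.-integrable setT (EFin \o (frac_kernel a \_ `]-oo, K])).
Proof.
move=> a0; apply/integrableP; split.
  apply/measurable_EFinP; apply/(measurable_restrictT (frac_kernel a)) => //.
  by apply: measurable_funTS; exact: measurable_frac_kernel.
have -> : (\int[mu]_x `|(EFin \o (frac_kernel a \_ `]-oo, K])) x| =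
    \int[mu]_(x in `]-oo, K]) ((eGamma a)^-1%:E * (tpow a x)%:E))%E.
  rewrite [RHS]integral_mkcond; apply: eq_integral => x _ /=.
  rewrite !patchE; case: ifP => _; last by rewrite normr0.
  by rewrite ger0_norm ?frac_kernel_ge0// -EFinM mulrC.
rewrite ge0_integralZl_EFin//.
- by rewrite lte_mul_pinfty// ?integral_tpow_ltoo// lee_fin invr_ge0 ltW// eGamma_gt0.
- by move=> x _; rewrite lee_fin tpow_ge0.
- by apply/measurable_EFinP; apply: measurable_funTS; exact: measurable_tpow.
- by rewrite invr_ge0 ltW// eGamma_gt0.
Qed.

Definition RLint a h t : R := \int[mu]_r (frac_kernel a (t - r) * h r).

Lemma measurable_RL a h t : measurable_fun setT h ->
  measurable_fun setT (fun r : R => frac_kernel a (t - r) * h r).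
Proof.
move=> mh; apply: measurable_funM => //; apply: measurableT_comp.
  exact: measurable_frac_kernel.
exact: measurable_funB.
Qed.

Lemma RL_integrable a h t : 0 < a -> causal h ->
  mu.-integrable setT (EFin \o (fun r : R => frac_kernel a (t - r) * h r)).
Proof.
move=> a0 [mh h0 hb]; have [M hM] := hb t.
pose g x : R := M * (frac_kernel a \_ `]-oo, t]) x.
have ig : mu.-integrable setT (EFin \o g).
  have := integrableZl measurableT M (integrable_frac_kernel t a0).
  by apply: eq_integrable => // x _; rewrite /g/= EFinM.
have M0 : 0 <= M by apply: le_trans (hM t (lexx _)).
have g0 x : 0 <= g x.
  by rewrite mulr_ge0// patchE; case: ifP => // _; exact: frac_kernel_ge0.
have igt := integrable_reflect t ig.
apply: le_integrable igt => //.
  by apply/measurable_EFinP; exact: measurable_RL.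
move=> r _ /=; rewrite lee_fin normrM ger0_norm ?frac_kernel_ge0//.
rewrite [leRHS]ger0_norm// /g.
have [tr|rt] := leP t r.
  by rewrite frac_kernel_le0 ?subr_le0// mul0r; exact: g0 (t - r).
have [r0|r0] := leP r 0.
  by rewrite h0// normr0 mulr0; exact: g0 (t - r).
rewrite patchE mem_set; last by rewrite /= in_itv/= gerBl ltW.
by rewrite mulrC ler_wpM2r ?frac_kernel_ge0// hM// ltW.
Qed.

Lemma RLint_le0 a h t : causal h -> t <= 0 -> RLint a h t = 0.
Proof.
move=> [_ h0 _] t0; rewrite /RLint /Rintegral integral0_eq// => r _.
have [r0|r0] := leP r 0; first by rewrite h0// mulr0.
by rewrite frac_kernel_le0 ?mul0r//; lra.
Qed.

(** Fubini, justified by Tonelli: integrating the absolute value first over the middle variable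
    leaves [frac_kernel (a + b)] against [|h|], which is integrable. *)
Lemma RLint_semigroup a b h t : 0 < a -> 0 < b -> causal h ->
  RLint a (RLint b h) t = RLint (a + b) h t.
Proof.
move=> a0 b0 ch; have [mh h0 hb] := ch.
pose f (z : R * R) : \bar R :=
  (frac_kernel a (t - z.1) * (frac_kernel b (z.1 - z.2) * h z.2))%:E.
have mfk c : measurable_fun setT (frac_kernel c) by exact: measurable_frac_kernel.
have mf : measurable_fun setT f.
  apply/measurable_EFinP; apply: measurable_funM.
    by apply: measurableT_comp => //; apply: measurable_funB.
  apply: measurable_funM; last exact: measurableT_comp.
  by apply: measurableT_comp => //; apply: measurable_funB.
have k0 c x : 0 < c -> 0 <= frac_kernel c x by exact: frac_kernel_ge0.
have mkk s : measurable_fun setT (fun x : R =>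
    (frac_kernel a (t - x) * frac_kernel b (x - s))%:E).
  apply/measurable_EFinP; apply: measurable_funM.
    by apply: measurableT_comp => //; exact: measurable_funB.
  by apply: measurableT_comp => //; exact: measurable_funB.
have kk0 s x : (0 <= (frac_kernel a (t - x) * frac_kernel b (x - s))%:E)%E.
  by rewrite lee_fin mulr_ge0// k0.
have convE s : (\int[mu]_r (frac_kernel a (t - r) * frac_kernel b (r - s))%:E =
    (frac_kernel (a + b) (t - s))%:E)%E.
  rewrite -(frac_kernel_conv (t - s) a0 b0).
  rewrite -[LHS](ge0_integral_shift s (mkk s) (kk0 s)).
  apply: eq_integral => r _; congr (frac_kernel a _ * frac_kernel b _)%:E; ring.
have intF : (mu \x mu)%E.-integrable setT f.
  apply/integrable21ltyP => //.
  have -> : (\int[mu]_y \int[mu]_x `|f (x, y)| =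
     \int[mu]_y `|(frac_kernel (a + b) (t - y) * h y)%:E|)%E.
    apply: eq_integral => y _; rewrite /f/= normrM EFinM.
    rewrite [X in (X%:E * _)%E]ger0_norm ?k0 ?addr_gt0// -convE.
    rewrite -ge0_integralZr//; last exact: mkk.
    apply: eq_integral => x _.
    rewrite (normrM (frac_kernel a _)) (normrM (frac_kernel b _)).
    by rewrite (ger0_norm (k0 _ _ a0)) (ger0_norm (k0 _ _ b0)) -EFinM mulrA.
  by have /integrableP[] := RL_integrable t (addr_gt0 a0 b0) ch.
have /(congr1 fine) := Fubini intF.
rewrite /RLint => e; transitivity (fine (\int[mu]_x \int[mu]_y f (x, y))%E).
  congr fine; apply: eq_integral => r _.
  have irb := RL_integrable r b0 ch.
  rewrite /f/= -RintegralZl//= /Rintegral fineK//.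
  apply: integrable_fin_num => //.
  have := integrableZl measurableT (frac_kernel a (t - r)) irb.
  by apply: eq_integrable => // x _; rewrite /= EFinM.
rewrite e; congr fine; apply: eq_integral => s _; rewrite /f/=.
transitivity (\int[mu]_r ((frac_kernel a (t - r) * frac_kernel b (r - s))%:E * (h s)%:E))%E.
  by apply: eq_integral => r _; rewrite -EFinM mulrA.
rewrite integralZr//.
  by rewrite convE -EFinM.
apply/integrableP; split; first exact: mkk.
under eq_integral do rewrite gee0_abs//.
by rewrite convE ltry.
Qed.

Lemma RLint_frac_kernel a b t : 0 < a -> 0 < b ->
  RLint a (frac_kernel b) t = frac_kernel (a + b) t.
Proof. by move=> a0 b0; rewrite /RLint /Rintegral frac_kernel_conv. Qed.

Lemma RLintE a h t : measurable_fun setT h ->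
  RLint a h t = \int[mu]_u (frac_kernel a u * h (t - u)).
Proof.
move=> mh; rewrite /RLint -(Rintegral_reflect t (measurable_RL a t mh)).
by apply: eq_Rintegral => u _; rewrite subKr.
Qed.

Lemma continuous_causal h : continuous h -> (forall x, x <= 0 -> h x = 0) ->
  causal h.
Proof.
move=> ch h0; split => //; first exact: continuous_measurable_fun.
move=> K; have [K0|K0] := leP 0 K; last first.
  by exists 0 => x xK; rewrite h0 ?normr0// (le_trans xK)// ltW.
have cn : {within `[0, K], continuous (fun x => `|h x|)}.
  apply: continuous_subspaceT => x; apply: continuous_comp; first exact: ch.
  exact: norm_continuous.
have [c _ hc] := EVT_max K0 cn; exists `|h c| => x xK.
have [x0|x0] := leP x 0; first by rewrite h0// normr0.
by apply: hc; rewrite in_itv/= xK ltW.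
Qed.

Lemma continuous_shift c h : continuous h -> continuous (fun t => h (t - c)).
Proof.
move=> ch t; apply: (@continuous_comp _ _ _ (fun t => t - c) h); last exact: ch.
by apply: cvgB; [exact: cvg_id|exact: cvg_cst].
Qed.

(** The kernel is singular but [h] is not: with [t] moved into the argument of [h], dominated
    convergence works with one majorant for all times near [t0]. *)
Lemma RLint_continuous a h : 0 < a -> continuous h ->
  (forall x, x <= 0 -> h x = 0) -> continuous (RLint a h).
Proof.
move=> a0 ch h0; have chh := continuous_causal ch h0; have [mh _ hb] := chh.
rewrite (_ : RLint a h = fun t => \int[mu]_u (frac_kernel a u * h (t - u))); last first.
  by apply/funext => t; exact: RLintE.
move=> t0; have [M hM] := hb (t0 + 1).
have M0 : 0 <= M by apply: le_trans (hM (t0 + 1) (lexx _)).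
pose g x : R := M * (frac_kernel a \_ `]-oo, t0 + 1]) x.
have ig : mu.-integrable setT (EFin \o g).
  have := integrableZl measurableT M (integrable_frac_kernel (t0 + 1) a0).
  by apply: eq_integrable => // x _; rewrite /g/= EFinM.
apply: (@continuity_under_integral _ _ _ mu (fun t u => frac_kernel a u * h (t - u))
  setT measurableT (t0 - 1) (t0 + 1) _ _ g ig); last first.
- by rewrite inE/= in_itv/=; apply/andP; split; lra.
- move=> t /=; rewrite in_itv/= => /andP[_ t1]; apply/aeW => u _.
  rewrite normrM ger0_norm ?frac_kernel_ge0// /g patchE; case: ifPn.
    rewrite inE/= in_itv/= => ut.
    have [u0|u0] := leP u 0; first by rewrite frac_kernel_le0// mul0r mulr0.
    by rewrite mulrC ler_wpM2r ?frac_kernel_ge0// hM//; lra.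
  rewrite notin_setE/= in_itv/= => /negP; rewrite -ltNge => tu.
  by rewrite h0 ?normr0 ?mulr0//; lra.
- apply/aeW => u _ t _; apply: cvgM; first exact: cvg_cst.
  exact: continuous_shift.
- move=> t _; have := integrable_reflect t (RL_integrable t a0 chh).
  by apply: eq_integrable => // x _; rewrite /= subKr.
Qed.

End RiemannLiouville.

(** * Continuity and derivatives of Riemann-Liouville integrals of data cut at 0 *)

Section RiemannLiouvilleContinuous.
Context {R : realType}.
Local Notation mu := (@lebesgue_measure R).
Implicit Types (a b c t x y : R) (h H : R -> R).

Lemma tpow_continuous a : 0 < a -> continuous (tpow (a + 1) : R -> R).
Proof.
move=> a0 x; have tE y : 0 < y -> tpow (a + 1) y = y `^ a.
  by move=> ?; rewrite tpow_gt0// addrK.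
apply/cvgrPdist_lt => e e0; have [x0|x0|->] := ltgtP x 0.
- near=> y; rewrite !tpow_le0 ?subrr ?normr0//; last exact: ltW.
  by apply: ltW; near: y; exact: lt_nbhsl.
- have : {for x, continuous ((@powR R) ^~ a)}.
    apply/differentiable_continuous/derivable1_diffP/derivable_powR.
    by rewrite in_itv/= x0.
  move=> /cvgrPdist_lt /(_ e e0) near_e; near=> y.
  by rewrite !tE//; near: y => //; exact: lt_nbhsr.
have d0 : 0 < e `^ a^-1 by exact: powR_gt0.
near=> y; have yd : y < e `^ a^-1.
  by near: y; exact: lt_nbhsl.
rewrite (tpow_le0 _ (lexx _)) sub0r normrN.
have [y0|y0] := leP y 0; first by rewrite tpow_le0 ?normr0.
rewrite tE// ger0_norm ?powR_ge0//.
have := gt0_ltr_powR a0 _ _ yd; rewrite !nnegrE (ltW y0) (ltW d0) => /(_ isT isT).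
by rewrite -powRrM mulVf ?gt_eqF// powRr1// ltW.
Unshelve. all: by end_near. Qed.

Lemma causal_frac_kernel1 : causal (frac_kernel 1 : R -> R).
Proof.
split; first exact: measurable_frac_kernel.
- by move=> x; exact: frac_kernel_le0.
move=> K; exists 1 => x _; rewrite /frac_kernel eGamma1 divr1 /tpow.
by case: ifP; rewrite ?normr0// subrr powRr0 normr1.
Qed.

Definition pos H x : R := if 0 < x then H x else 0.

Lemma measurable_pos H : measurable_fun setT H -> measurable_fun setT (pos H).
Proof. by move=> mH; apply: measurable_fun_ifT => //; exact: measurable_fun_ltr. Qed.

Lemma causal_pos H : continuous H -> causal (pos H).
Proof.
move=> cH; split.
- by apply: measurable_pos; exact: continuous_measurable_fun.
- by move=> x x0; rewrite /pos ltNge x0.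
move=> K; have cn : {within `[0, Num.max K 0], continuous (fun x => `|H x|)}.
  apply: continuous_subspaceT => x; apply: continuous_comp; first exact: cH.
  exact: norm_continuous.
have K0 : 0 <= Num.max K 0 by rewrite le_max lexx orbT.
have [c _ hc] := EVT_max K0 cn; exists `|H c| => x xK; rewrite /pos.
case: ifP => x0; last by rewrite normr0.
by apply: hc; rewrite in_itv/= le_max xK ltW.
Qed.

(** [pos H] may jump at 0. Subtracting [H 0] times the Heaviside function [frac_kernel 1] leaves a
    continuous function, and [J^a] of the Heaviside function is the continuous
    [frac_kernel (a + 1)]. *)
Lemma RLint_pos_continuous a H : 0 < a -> continuous H ->
  continuous (RLint a (pos H)).
Proof.
move=> a0 cH; pose h1 x := H (Num.max x 0) - H 0.
have ch1 : continuous h1.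
  move=> x; apply: cvgB; last exact: cvg_cst.
  apply: (@continuous_comp _ _ _ (fun x => Num.max x 0) H); last exact: cH.
  by apply: (@continuous_max _ _ id (fun=> 0)); [exact: cvg_id|exact: cvg_cst].
have h10 x : x <= 0 -> h1 x = 0 by move=> x0; rewrite /h1 max_r// subrr.
have posE x : pos H x = h1 x + H 0 * frac_kernel 1 x.
  rewrite /pos /frac_kernel eGamma1 divr1 /tpow /h1.
  case: ltP => x0; last by rewrite subrr mulr0 addr0.
  by rewrite subrr powRr0 mulr1 subrK.
rewrite (_ : RLint a (pos H) = fun t => RLint a h1 t + H 0 * frac_kernel (a + 1) t).
  move=> t; apply: cvgD; first exact: RLint_continuous.
  apply: cvgM; first exact: cvg_cst.
  apply: cvgM; last exact: cvg_cst.
  exact: tpow_continuous.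
apply/funext => t; rewrite -RLint_frac_kernel//.
have i1 := RL_integrable t a0 (continuous_causal ch1 h10).
have i2 := RL_integrable t a0 causal_frac_kernel1.
rewrite /RLint -RintegralZl//.
rewrite -RintegralD//.
  apply: eq_Rintegral => r _.
  by rewrite (posE r) mulrDr (mulrCA (frac_kernel a (t - r))).
have := integrableZl measurableT (H 0) i2.
by apply: eq_integrable => // x _; rewrite /= EFinM.
Qed.

Lemma RLint1E h t : measurable_fun setT h ->
  RLint 1 h t = \int[mu]_(r in `]-oo, t]) h r.
Proof.
move=> mh; rewrite /Rintegral -integral_itv_bndo_bndc; last first.
  by apply/measurable_EFinP; exact: measurable_funTS.
rewrite integral_mkcond /RLint; congr fine; apply: eq_integral => r _.
rewrite patchE /frac_kernel eGamma1 divr1 /tpow subr_gt0 subrr powRr0.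
case: ltP => rt; first by rewrite mem_set ?mul1r//= in_itv/=.
by rewrite memNset ?mul0r//= in_itv/=; apply/negP; rewrite -leNgt.
Qed.

(** [J^(b + 1) = J^1 J^b], and [J^1] of a continuous causal function is a primitive of it. *)
Lemma is_derive_RLint b h t : 0 < b -> causal h -> continuous (RLint b h) ->
  is_derive t 1 (RLint (b + 1) h) (RLint b h t).
Proof.
move=> b0 ch cR; set g := RLint b h.
have mg : measurable_fun setT g by exact: continuous_measurable_fun.
have cg : causal g by apply: continuous_causal => // x; exact: RLint_le0.
have e1 s : RLint (b + 1) h s = \int[mu]_(r in `]-oo, s]) g r.
  by rewrite addrC -(RLint_semigroup s ltr01 b0 ch); exact: RLint1E.
rewrite (funext e1).
have ig : mu.-integrable `]-oo, t + 1] (EFin \o g).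
  (* At time [t + 2] the kernel of [J^1] equals 1 on all of []-oo, t + 1]]. *)
  have iT := RL_integrable (t + 1 + 1) ltr01 cg.
  have : mu.-integrable `]-oo, t + 1]
      (EFin \o (fun r => frac_kernel 1 (t + 1 + 1 - r) * g r)).
    exact: (integrableS _ _ _ iT).
  apply: eq_integrable => // x; rewrite inE/= in_itv/= => xt.
  rewrite /frac_kernel eGamma1 divr1 tpow_gt0 ?subrr ?powRr0 ?mul1r//; lra.
have tt1 : t < t + 1 by rewrite ltrDl.
have [d e] := @continuous_FTC1 R g -oo%O t (t + 1) tt1 ig (ltNyr _) (cR t).
by apply: DeriveDef; [exact: d|rewrite -derive1E; exact: e].
Qed.

(** Passage from the integral over [[0, t]] in the definition to the convolution over the line. The
    integrands can disagree on [[0, t]] only at the endpoints, because of the conventions for powers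
    of 0 and for the cut. *)
Lemma frac_integrand_integrable b H t : 0 < b -> continuous H ->
  mu.-integrable `[0, t] (fun r => ((t - r) `^ (b - 1) * H r)%:E) /\
  \int[mu]_(r in `[0, t]) ((t - r) `^ (b - 1) * H r) =
    eGamma b * RLint b (pos H) t.
Proof.
move=> b0 cH; have mH := continuous_measurable_fun cH.
pose F r := (t - r) `^ (b - 1) * H r.
have mF : measurable_fun setT F.
  apply: measurable_funM => //.
  apply: (@measurableT_comp _ _ _ _ _ _ ((@powR R) ^~ (b - 1))) => //.
  exact: measurable_funB.
have clE (G : R -> \bar R) : measurable_fun setT G ->
    (\int[mu]_(r in `[0%R, t]) G r = \int[mu]_(r in `]0%R, t[) G r)%E.
  move=> mG; rewrite -integral_itv_bndo_bndc; last exact: measurable_funTS.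
  by rewrite -integral_itv_obnd_cbnd//; exact: measurable_funTS.
have FE r : (F \_ `]0, t[) r = eGamma b * (frac_kernel b (t - r) * pos H r).
  rewrite patchE; case: ifPn.
    rewrite inE/= in_itv/= => /andP[r0 rt].
    rewrite /frac_kernel /pos r0 tpow_gt0 ?subr_gt0// /F; field.
    by rewrite gt_eqF// eGamma_gt0.
  rewrite notin_setE/= in_itv/= => /negP; rewrite negb_and -!leNgt.
  move=> /orP[r0|tr]; first by rewrite /pos ltNge r0 !mulr0.
  by rewrite frac_kernel_le0 ?subr_le0// mul0r mulr0.
have iR := RL_integrable t b0 (causal_pos cH).
have iF : mu.-integrable setT (EFin \o (F \_ `]0, t[)).
  have := integrableZl measurableT (eGamma b) iR.
  by apply: eq_integrable => // x _; rewrite /= FE EFinM.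
split.
  apply/integrableP; split; first by apply/measurable_EFinP; exact: measurable_funTS.
  rewrite (clE (fun r => `|(F r)%:E|%E)); last first.
    by apply: measurableT_comp => //; exact/measurable_EFinP.
  case/integrableP : iF => _; rewrite [X in _ -> (X < _)%E]integral_mkcond.
  congr (_ < _)%E; apply: eq_integral => r _ /=; rewrite !patchE.
  by case: ifP => // _; rewrite normr0.
rewrite {1}/Rintegral (clE (fun r => (F r)%:E)); last exact/measurable_EFinP.
rewrite -RintegralZl// integral_mkcond; congr fine; apply: eq_integral => r _.
by rewrite -FE restrict_EFin.
Qed.

End RiemannLiouvilleContinuous.

(** * Real and imaginary parts *)

Section ComplexParts.
Context {R : realType}.
Implicit Types (x : R) (z w : R[i]).

Lemma complexP z w : complex.Re z = complex.Re w ->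
  complex.Im z = complex.Im w -> z = w.
Proof. by case: z w => [a b] [c d] /= -> ->. Qed.

Lemma ReDc z w : complex.Re (z + w) = complex.Re z + complex.Re w.
Proof. by case: z w => [a b] [c d]. Qed.

Lemma ImDc z w : complex.Im (z + w) = complex.Im z + complex.Im w.
Proof. by case: z w => [a b] [c d]. Qed.

Lemma ReMc z w : complex.Re (z * w) =
  complex.Re z * complex.Re w - complex.Im z * complex.Im w.
Proof. by case: z w => [a b] [c d]. Qed.

Lemma ImMc z w : complex.Im (z * w) =
  complex.Re z * complex.Im w + complex.Im z * complex.Re w.
Proof. by case: z w => [a b] [c d]. Qed.

Lemma ReMrc x z : complex.Re (x%:C * z) = x * complex.Re z.
Proof. by rewrite ReMc /= mul0r subr0. Qed.

Lemma ImMrc x z : complex.Im (x%:C * z) = x * complex.Im z.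
Proof. by rewrite ImMc /= mul0r addr0. Qed.

Lemma complex_recompose z :
  'i * (complex.Im z)%:C + (complex.Re z)%:C = z.
Proof.
apply: complexP; rewrite ?ReDc ?ImDc ?ReMc ?ImMc/=.
  by rewrite mul0r mul1r subr0 add0r.
by rewrite !mul0r mul1r add0r addr0.
Qed.

End ComplexParts.

(** * Complex fractional integrals and the delayed terms of the series *)

Section MethodOfSteps.
Context {R : realType}.
Local Notation mu := (@lebesgue_measure R).
Implicit Types (a b t : R) (u : R -> R[i]) (v : R[i]) (H : R -> R).

Lemma integrable_realD (D : set R) (f g : R -> R) : measurable D ->
  mu.-integrable D (fun x => (f x)%:E) -> mu.-integrable D (fun x => (g x)%:E) ->
  mu.-integrable D (fun x => (f x + g x)%:E).
Proof.
move=> mD fi gi; have := integrableD _ fi gi.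
by move=> /(_ mD); apply: eq_integrable => // x _; rewrite EFinD.
Qed.

Lemma integrable_realZ (D : set R) (f : R -> R) (c : R) : measurable D ->
  mu.-integrable D (fun x => (f x)%:E) -> mu.-integrable D (fun x => (c * f x)%:E).
Proof.
move=> mD fi; have := integrableZl _ c fi.
by move=> /(_ mD); apply: eq_integrable => // x _; rewrite EFinM.
Qed.

Lemma Rintegral_realD (D : set R) (f g : R -> R) : measurable D ->
  mu.-integrable D (fun x => (f x)%:E) -> mu.-integrable D (fun x => (g x)%:E) ->
  \int[mu]_(x in D) (f x + g x) =
  \int[mu]_(x in D) f x + \int[mu]_(x in D) g x.
Proof. by move=> mD fi gi; rewrite RintegralD. Qed.

Lemma Rintegral_realZ (D : set R) (f : R -> R) (c : R) : measurable D ->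
  mu.-integrable D (fun x => (f x)%:E) ->
  \int[mu]_(x in D) (c * f x) = c * \int[mu]_(x in D) f x.
Proof. by move=> mD fi; rewrite RintegralZl. Qed.

(** Integrability travels with the value, since additivity of [cintegral] relies on it. *)
Definition frac_integrable b t u v :=
  [/\ mu.-integrable `[0, t] (fun r => ((t - r) `^ (b - 1) * complex.Re (u r))%:E),
      mu.-integrable `[0, t] (fun r => ((t - r) `^ (b - 1) * complex.Im (u r))%:E) &
      frac_integral b u t = v].

Lemma frac_integralE b u t : frac_integral b u t =
  ((eGamma b)^-1 * \int[mu]_(r in `[0, t]) ((t - r) `^ (b - 1) * complex.Re (u r))) +i*
  ((eGamma b)^-1 * \int[mu]_(r in `[0, t]) ((t - r) `^ (b - 1) * complex.Im (u r))).
Proof.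
rewrite /frac_integral /cintegral; apply: complexP; rewrite ?ReMrc ?ImMrc /=.
  by congr (_ * _); apply: eq_Rintegral => r _; rewrite ReMrc.
by congr (_ * _); apply: eq_Rintegral => r _; rewrite ImMrc.
Qed.

Lemma frac_integrableD b t u1 u2 v1 v2 : frac_integrable b t u1 v1 ->
  frac_integrable b t u2 v2 ->
  frac_integrable b t (fun r => u1 r + u2 r) (v1 + v2).
Proof.
have mI := measurable_itv `[0, t].
move=> [r1 i1 <-] [r2 i2 <-]; split.
- have := integrable_realD mI r1 r2.
  by apply: eq_integrable => // r _ /=; rewrite ReDc mulrDr.
- have := integrable_realD mI i1 i2.
  by apply: eq_integrable => // r _ /=; rewrite ImDc mulrDr.
rewrite !frac_integralE; apply: complexP => /=; rewrite -mulrDr -RintegralD//.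
  by congr (_ * _); apply: eq_Rintegral => r _; rewrite ReDc mulrDr.
by congr (_ * _); apply: eq_Rintegral => r _; rewrite ImDc mulrDr.
Qed.

Lemma frac_integrableZ b t (c : R[i]) u v : frac_integrable b t u v ->
  frac_integrable b t (fun r => c * u r) (c * v).
Proof.
move=> [ir ii <-]; have mI := measurable_itv `[0, t].
set w := fun r => (t - r) `^ (b - 1).
have zr x := integrable_realZ x mI ir; have zi x := integrable_realZ x mI ii.
split.
- have := integrable_realD mI (zr (complex.Re c)) (zi (- complex.Im c)).
  by apply: eq_integrable => // r _ /=; rewrite ReMc; congr (_%:E); ring.
- have := integrable_realD mI (zi (complex.Re c)) (zr (complex.Im c)).
  by apply: eq_integrable => // r _ /=; rewrite ImMc; congr (_%:E); ring.
rewrite !frac_integralE; apply: complexP; rewrite ?ReMc ?ImMc/=.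
  rewrite [RHS](_ : _ = (eGamma b)^-1 * (complex.Re c *
    \int[mu]_(r in `[0, t]) (w r * complex.Re (u r)) - complex.Im c *
    \int[mu]_(r in `[0, t]) (w r * complex.Im (u r)))); last by rewrite /w; ring.
  rewrite -(Rintegral_realZ _ mI ir) -mulNr -(Rintegral_realZ _ mI ii).
  rewrite -(Rintegral_realD mI (zr _) (zi _)); congr (_ * _).
  by apply: eq_Rintegral => r _; rewrite ReMc /w/=; ring.
rewrite [RHS](_ : _ = (eGamma b)^-1 * (complex.Re c *
    \int[mu]_(r in `[0, t]) (w r * complex.Im (u r)) + complex.Im c *
    \int[mu]_(r in `[0, t]) (w r * complex.Re (u r)))); last by rewrite /w; ring.
rewrite -(Rintegral_realZ _ mI ii) -(Rintegral_realZ _ mI ir).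
rewrite -(Rintegral_realD mI (zi _) (zr _)); congr (_ * _).
by apply: eq_Rintegral => r _; rewrite ImMc /w/=; ring.
Qed.

Lemma frac_integrable_real b t H : 0 < b -> continuous H ->
  frac_integrable b t (fun r => (H r)%:C) (RLint b (pos H) t)%:C.
Proof.
move=> b0 cH; have [iH eH] := frac_integrand_integrable t b0 cH; split => //=.
  have : mu.-integrable `[0, t] (cst 0%E) by exact: integrable0.
  by apply: eq_integrable => // r _; rewrite mulr0.
rewrite frac_integralE; apply: complexP => /=.
  by rewrite eH mulrA mulVf ?mul1r// gt_eqF// eGamma_gt0.
by under eq_Rintegral do rewrite mulr0; rewrite Rintegral_cst// mul0r mulr0.
Qed.

Lemma frac_integrable_sum b t n (u : nat -> R -> R[i]) (v : nat -> R[i]) :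
  0 < b -> (forall k, (k < n)%N -> frac_integrable b t (u k) (v k)) ->
  frac_integrable b t (fun r => \sum_(0 <= k < n) u k r) (\sum_(0 <= k < n) v k).
Proof.
move=> b0; elim: n => [_|n ih hu].
  have := frac_integrableZ 0 (frac_integrable_real t b0 (@cst_continuous _ _ (0 : R))).
  have -> : (fun r => \sum_(0 <= k < 0) u k r) = fun=> 0.
    by apply/funext => r; rewrite big_geq.
  by rewrite big_geq// !mul0r.
rewrite big_nat_recr//=; under eq_fun do rewrite big_nat_recr//=.
by apply: frac_integrableD; [apply: ih => k kn; apply: hu; exact: ltnW|exact: hu].
Qed.

Lemma eq_frac_integral b t u1 u2 : (forall r, 0 <= r <= t -> u1 r = u2 r) ->
  frac_integral b u1 t = frac_integral b u2 t.
Proof.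
move=> e; rewrite !frac_integralE; apply: complexP => /=; congr (_ * _);
  by apply: eq_Rintegral => r; rewrite inE/= in_itv/= => /e ->.
Qed.

Lemma RLint_shift a H s t : measurable_fun setT H ->
  RLint a (fun r => H (r - s)) t = RLint a H (t - s).
Proof.
move=> mH; rewrite /RLint -(Rintegral_shift s); last first.
  apply: measurable_RL; apply: (measurableT_comp mH); exact: measurable_funB.
apply: eq_Rintegral => r _; rewrite addrK; congr (frac_kernel a _ * _); ring.
Qed.

Variables alpha tau : R.
Hypotheses (alpha0 : 0 < alpha) (tau0 : 0 < tau).

Definition delayed_RLint k H t := RLint (k.+1%:R * alpha) (pos H) (t - k%:R * tau).

Let order0 k : 0 < k.+1%:R * alpha.
Proof. by rewrite mulr_gt0. Qed.

Lemma delayed_RLint_continuous k H : continuous H ->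
  continuous (delayed_RLint k H).
Proof.
move=> cH; apply: (@continuous_shift R _ (RLint (k.+1%:R * alpha) (pos H))).
exact: RLint_pos_continuous.
Qed.

Lemma delayed_RLint_le0 k H t : continuous H -> t <= k%:R * tau ->
  delayed_RLint k H t = 0.
Proof.
by move=> cH tk; rewrite /delayed_RLint RLint_le0 ?subr_le0//; exact: causal_pos.
Qed.

(** Passing a term once more through the delay equation raises its order by [alpha] and its delay by
    [tau]. The cut [pos] changes nothing, because the shifted term already vanishes for [r <= 0]. *)
Lemma delayed_RLint_succ k H t : continuous H ->
  RLint alpha (pos (fun r => delayed_RLint k H (r - tau))) t =
  delayed_RLint k.+1 H t.
Proof.
have natS (n : nat) : n.+1%:R = n%:R + 1 :> R by rewrite natr1.
move=> cH; set g := RLint (k.+1%:R * alpha) (pos H).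
have cg : continuous g by exact: RLint_pos_continuous.
have -> : pos (fun r => delayed_RLint k H (r - tau)) = fun r => g (r - k.+1%:R * tau).
  apply/funext => r; have -> : g (r - k.+1%:R * tau) = delayed_RLint k H (r - tau).
    by rewrite /delayed_RLint; congr g; rewrite (natS k); ring.
  rewrite /pos; case: ltP => // r0; rewrite delayed_RLint_le0//.
  have : 0 <= k%:R * tau by rewrite mulr_ge0// ltW.
  by move=> kt; apply: (le_trans _ kt); rewrite subr_le0 (le_trans r0)// ltW.
rewrite RLint_shift; last exact: continuous_measurable_fun.
rewrite /g (RLint_semigroup _ alpha0 (order0 k) (causal_pos cH)).
have -> : alpha + k.+1%:R * alpha = k.+2%:R * alpha by rewrite (natS k.+1); ring.
by [].
Qed.

End MethodOfSteps.

(** * Iteration of the integral equation *)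

Section DelaySolution.
Context {R : realType}.
Variables (alpha tau : R) (lambda : R[i]) (f phi Phi F : R -> R) (y : R -> R[i]).
Hypotheses (alpha0 : 0 < alpha) (tau0 : 0 < tau).
Hypotheses (cPhi : continuous Phi) (cF : continuous F).
Hypothesis PhiE : forall r, 0 <= r -> Phi r = phi (Num.min (r - tau) 0).
Hypothesis FE : forall r, 0 <= r -> F r = f r.
Hypothesis solution : delay_solution alpha tau lambda f phi y.

Local Notation A := (delayed_RLint alpha tau).

(** Terms with [k tau >= t] are 0, so one formula with [N] terms covers all [t < N tau]. This
    uniformity serves the induction on [N], where the delayed times lie one step lower. *)
Lemma delay_solution_steps N t : 0 <= t < N%:R * tau ->
  y t = (phi 0)%:C +
    \sum_(0 <= k < N) (lambda ^+ k.+1 * (A k Phi t)%:C + lambda ^+ k * (A k F t)%:C).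
Proof.
have [_ yphi yE] := solution.
elim: N t => [|N ih] t /andP[t0 tN].
  by move: (le_lt_trans t0 tN); rewrite mul0r ltxx.
rewrite (yE _ t0); congr (_ + _).
pose u k r : R[i] := lambda ^+ k.+2 * (A k Phi (r - tau))%:C +
  lambda ^+ k.+1 * (A k F (r - tau))%:C.
rewrite (@eq_frac_integral _ _ _ _ (fun r => (lambda * (Phi r)%:C + (F r)%:C) +
    \sum_(0 <= k < N) u k r)); last first.
  move=> r /andP[r0 rt]; rewrite FE// PhiE//.
  (* Before [tau] the delayed value is given by [phi] and every [u k r] vanishes; from [tau] on,
     [Phi r = phi 0] is the constant part of the induction hypothesis at [r - tau]. *)
  have [rtau|rtau] := ltP r tau.
    rewrite min_l; last by rewrite subr_le0 ltW.
    rewrite yphi; last by rewrite lerBrDr addNr r0 subr_le0 ltW.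
    rewrite big1_seq ?addr0// => k _; rewrite /u !delayed_RLint_le0// ?mulr0 ?addr0//.
      by apply: (@le_trans _ _ 0); rewrite ?subr_le0 ?mulr_ge0// ltW.
    by apply: (@le_trans _ _ 0); rewrite ?subr_le0 ?mulr_ge0// ltW.
  rewrite min_r ?subr_ge0// ih; last first.
    rewrite subr_ge0 rtau ltrBlDr (le_lt_trans rt)// (lt_le_trans tN)//.
    by rewrite -natr1 mulrDl mul1r.
  rewrite mulrDr big_distrr/= addrAC -!addrA; congr (_ + (_ + _)).
  by apply: eq_bigr => k _; rewrite /u mulrDr !mulrA -!exprS.
have shc k H : continuous H -> continuous (fun r => A k H (r - tau)).
  move=> cH; apply: (@continuous_shift R _ (A k H)).
  exact: delayed_RLint_continuous.
have i1 := frac_integrableD (frac_integrableZ lambda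
  (frac_integrable_real t alpha0 cPhi)) (frac_integrable_real t alpha0 cF).
have i2 k : (k < N)%N -> frac_integrable alpha t (u k)
    (lambda ^+ k.+2 * (A k.+1 Phi t)%:C + lambda ^+ k.+1 * (A k.+1 F t)%:C).
  move=> _; rewrite -!delayed_RLint_succ//; apply: frac_integrableD.
    apply: frac_integrableZ; apply: frac_integrable_real => //; exact: shc.
  apply: frac_integrableZ; apply: frac_integrable_real => //; exact: shc.
have [_ _ ->] := frac_integrableD i1 (frac_integrable_sum alpha0 i2).
have A0 H : A 0 H t = RLint alpha (pos H) t.
  by rewrite /delayed_RLint mul0r subr0 mul1r.
by rewrite [RHS]big_nat_recl// !A0 expr1 expr0 mul1r.
Qed.

End DelaySolution.

(** * Calculus of smooth real functions *)

Section SmoothFunctions.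
Context {R : realType}.
Implicit Types (u v w : R -> R) (n m k : nat) (x c : R).

Definition rsmooth u := forall n x, derivable (derive1n n u) x 1.

(** Differentiates on the inside, whereas [derive1n] unfolds on the outside: closure properties
    become inductions on [n] with [u] varying. *)
Fixpoint Cn n u : Prop :=
  if n is m.+1 then (forall x, derivable u x 1) /\ Cn m u^`()%classic else True.

Lemma rsmoothP u : rsmooth u <-> forall n, Cn n u.
Proof.
split=> [su n|cu n].
  elim: n u su => //= n ih u su; split; first exact: (su 0).
  by apply: ih => k x; rewrite -derive1Sn; exact: su.
elim: n u cu => [|n ih] u cu x; first by have [] := cu 1.
by rewrite derive1Sn; apply: ih => k; have [] := cu k.+1.
Qed.

Lemma Cn_le n m u : (m <= n)%N -> Cn n u -> Cn m u.
Proof.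
by elim: n m u => [[]//|n ih] [//|m] u /= mn [du cu]; split=> //; exact: ih.
Qed.

Lemma Cn_is_derive n u v : (forall x, is_derive x 1 u (v x)) -> Cn n v -> Cn n.+1 u.
Proof.
move=> uv cv; split=> [x|]; first by have [] := uv x.
rewrite (_ : u^`()%classic = v)//; apply/funext => x.
by rewrite derive1E; have [_ ->] := uv x.
Qed.

Lemma is_derive_continuous u v : (forall x, is_derive x 1 u (v x)) -> continuous u.
Proof.
by move=> uv x; apply/differentiable_continuous/derivable1_diffP; have [] := uv x.
Qed.

Lemma Cn_derivative n u x : Cn n.+1 u -> is_derive x 1 u (u^`()%classic x).
Proof. by move=> [du _]; rewrite derive1E; exact/derivableP. Qed.

Lemma Cn_cst n c : Cn n (fun=> c).
Proof.
elim: n c => // n ih c; exact: (@Cn_is_derive _ _ (fun=> 0)).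
Qed.

Lemma CnD n u v : Cn n u -> Cn n v -> Cn n (fun x => u x + v x).
Proof.
elim: n u v => // n ih u v cu cv.
have duv x : is_derive x 1 (fun x => u x + v x) (u^`()%classic x + v^`()%classic x).
  have := Cn_derivative x cu; have := Cn_derivative x cv => dv du.
  exact: is_deriveD.
apply: (Cn_is_derive duv).
by apply: ih; [case: cu|case: cv].
Qed.

Lemma CnM n u v : Cn n u -> Cn n v -> Cn n (fun x => u x * v x).
Proof.
elim: n u v => // n ih u v cu cv.
have duv x : is_derive x 1 (fun x => u x * v x)
    (u^`()%classic x * v x + u x * v^`()%classic x).
  have := Cn_derivative x cu; have := Cn_derivative x cv => dv du.
  apply: (is_derive_eq (is_deriveM du dv)).
  by rewrite addrC /GRing.scale/= (mulrC (v x)).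
apply: (Cn_is_derive duv).
apply: CnD; apply: ih; try (exact: (Cn_le (leqnSn n))); by case: cu cv => _ ? [].
Qed.

Lemma CnZ n c u : Cn n u -> Cn n (fun x => c * u x).
Proof. by move=> cu; apply: CnM => //; exact: Cn_cst. Qed.

Lemma Cn_affine n a c u : Cn n u -> Cn n (fun x => u (a * x + c)).
Proof.
elim: n u => // n ih u cu.
have dua x : is_derive x 1 (fun x => u (a * x + c)) (a * u^`()%classic (a * x + c)).
  have du := Cn_derivative (a * x + c) cu.
  have da : is_derive x 1 (fun x => a * x + c) a.
    by apply: is_derive_eq; rewrite /GRing.scale/= mulr1 addr0.
  by rewrite mulrC; exact: (@is_derive1_comp R u (fun x => a * x + c) x _ _ du da).
by apply: (Cn_is_derive dua); apply: CnZ; apply: ih; case: cu.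
Qed.

(** The derivative [- u' (1/u)^2] contains [1/u] again, but one order lower. *)
Lemma CnV n u : (forall x, u x != 0) -> Cn n u -> Cn n (fun x => (u x)^-1).
Proof.
move=> u0; elim: n => // n ih cu; have cn := ih (Cn_le (leqnSn n) cu).
have dV x : is_derive x 1 (fun x => (u x)^-1)
    (- u^`()%classic x * ((u x)^-1 * (u x)^-1)).
  have du := Cn_derivative x cu.
  apply: (is_derive_eq (is_deriveV (u0 x) du)).
  by rewrite /GRing.scale/= expr2 invfM; ring.
apply: (Cn_is_derive dV).
apply: CnM; last exact: CnM.
rewrite (_ : (fun x => _) = fun x => (-1) * u^`()%classic x).
  by apply: CnZ; case: cu.
by apply/funext => x; rewrite mulN1r.
Qed.

Lemma rsmooth_cst c : rsmooth (fun=> c).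
Proof. by apply/rsmoothP => n; exact: Cn_cst. Qed.

Lemma rsmoothD u v : rsmooth u -> rsmooth v -> rsmooth (fun x => u x + v x).
Proof. by move=> /rsmoothP cu /rsmoothP cv; apply/rsmoothP => n; exact: CnD. Qed.

Lemma rsmoothM u v : rsmooth u -> rsmooth v -> rsmooth (fun x => u x * v x).
Proof. by move=> /rsmoothP cu /rsmoothP cv; apply/rsmoothP => n; exact: CnM. Qed.

Lemma rsmoothZ c u : rsmooth u -> rsmooth (fun x => c * u x).
Proof. by move=> /rsmoothP cu; apply/rsmoothP => n; exact: CnZ. Qed.

Lemma rsmooth_affine a c u : rsmooth u -> rsmooth (fun x => u (a * x + c)).
Proof. by move=> /rsmoothP cu; apply/rsmoothP => n; exact: Cn_affine. Qed.

Lemma rsmooth_derive u : rsmooth u -> rsmooth u^`()%classic.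
Proof. by move=> su n x; rewrite -derive1Sn; exact: su. Qed.

Lemma rsmooth_is_derive u x : rsmooth u -> is_derive x 1 u (u^`()%classic x).
Proof. by move=> /rsmoothP /(_ 1); exact: Cn_derivative. Qed.

Lemma rsmooth_continuous u : rsmooth u -> continuous u.
Proof.
by move=> su x; apply/differentiable_continuous/derivable1_diffP; exact: (su 0).
Qed.

Lemma derive1_eq u v : (forall x, is_derive x 1 u (v x)) -> u^`()%classic = v.
Proof. by move=> uv; apply/funext => x; rewrite derive1E; have [_ ->] := uv x. Qed.

Lemma derive1nD n u v : rsmooth u -> rsmooth v ->
  derive1n n (fun x => u x + v x) = fun x => derive1n n u x + derive1n n v x.
Proof.
elim: n u v => // n ih u v su sv; rewrite !derive1Sn -ih; try exact: rsmooth_derive.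
congr derive1n; apply: derive1_eq => x.
have := rsmooth_is_derive x su; have := rsmooth_is_derive x sv => dv du.
exact: is_deriveD.
Qed.

Lemma derive1M u v : rsmooth u -> rsmooth v -> (fun x => u x * v x)^`()%classic =
  fun x => u^`()%classic x * v x + u x * v^`()%classic x.
Proof.
move=> su sv; apply: derive1_eq => x.
have := rsmooth_is_derive x su; have := rsmooth_is_derive x sv => dv du.
apply: (is_derive_eq (is_deriveM du dv)).
by rewrite addrC /GRing.scale/= (mulrC (v x)).
Qed.

Lemma derive1nZ n c u : rsmooth u ->
  derive1n n (fun x => c * u x) = fun x => c * derive1n n u x.
Proof.
elim: n u => // n ih u su; rewrite !derive1Sn -ih; last exact: rsmooth_derive.
congr derive1n; apply: derive1_eq => x.
have du := rsmooth_is_derive x su.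
exact: (@is_deriveZ _ _ _ u c x 1 _ du).
Qed.

Lemma derive1n_cst n c x : derive1n n.+1 (fun=> c) x = 0.
Proof.
rewrite derive1Sn (_ : (fun=> c)^`()%classic = fun=> 0); last first.
  by apply/funext => z; rewrite derive1_cst.
elim: n => // n ih; rewrite derive1Sn (_ : (fun=> 0)^`()%classic = fun=> 0)//.
by apply/funext => z; rewrite derive1_cst.
Qed.

Lemma derive1n_shift n c u x : rsmooth u ->
  derive1n n (fun x => u (x + c)) x = derive1n n u (x + c).
Proof.
elim: n u => // n ih u su; rewrite !derive1Sn -ih; last exact: rsmooth_derive.
congr (derive1n n _ x); apply: derive1_eq => z.
have du := rsmooth_is_derive (z + c) su.
have dz : is_derive z 1 (fun x => x + c) 1 by apply: is_derive_eq; rewrite addr0.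
rewrite -[X in is_derive _ _ _ X]mulr1.
exact: (@is_derive1_comp R u (fun x => x + c) z _ _ du dz).
Qed.

Lemma derive1n_local n (D : set R) u v : open D -> (forall x, D x -> u x = v x) ->
  forall x, D x -> derive1n n u x = derive1n n v x.
Proof.
move=> oD; elim: n u v => [|n ih] u v uv x Dx; first exact: uv.
rewrite !derive1Sn; apply: (ih _ _ _ x Dx) => {Dx}x Dx.
rewrite !derive1E; apply: near_eq_derive.
by near=> z; apply: uv; near: z; exact: open_nbhs_nbhs.
Unshelve. all: by end_near. Qed.

(** Each derivation doubles the number of products, whence [2 ^+ n]. *)
Lemma derive1nM_le n u v x (A d : R) : rsmooth u -> rsmooth v -> 0 <= A -> 0 <= d ->
  (forall i, (i <= n)%N -> `|derive1n i u x| <= A) ->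
  (forall i, (i <= n)%N -> `|derive1n i v x| <= d) ->
  `|derive1n n (fun x => u x * v x) x| <= 2 ^+ n * A * d.
Proof.
move=> su sv A0 d0; elim: n u v su sv => [|n ih] u v su sv hu hv.
  by rewrite mul1r normrM ler_pM//; [exact: (hu 0)|exact: (hv 0)].
have su' := rsmooth_derive su; have sv' := rsmooth_derive sv.
rewrite derive1Sn (derive1M su sv) (derive1nD _ (rsmoothM su' sv) (rsmoothM su sv')).
have e : 2 ^+ n.+1 * A * d = 2 ^+ n * A * d + 2 ^+ n * A * d by rewrite exprS; ring.
apply: (le_trans (ler_normD _ _)); rewrite e; apply: lerD.
  apply: (ih _ _ su' sv); last by move=> i iN; apply: hv; exact: leqW.
  by move=> i iN; rewrite -derive1Sn; exact: hu.
apply: (ih _ _ su sv'); first by move=> i iN; apply: hu; exact: leqW.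
by move=> i iN; rewrite -derive1Sn; exact: hv.
Qed.

Lemma is_derive_exp c x : is_derive x 1 (fun x => expR (c * x)) (c * expR (c * x)).
Proof.
have dc : is_derive x 1 (fun x => c * x) c.
  by apply: is_derive_eq; rewrite /GRing.scale/= mulr1.
rewrite mulrC.
exact: (@is_derive1_comp R expR (fun x => c * x) x _ _ (is_derive_expR _) dc).
Qed.

Lemma rsmooth_exp c : rsmooth (fun x => expR (c * x)).
Proof.
apply/rsmoothP => n; elim: n => // n ih.
exact: (Cn_is_derive (is_derive_exp c) (CnZ c ih)).
Qed.

End SmoothFunctions.

(** * A smooth cutoff around the negative half-line *)

Section Cutoff.
Context {R : realType}.
Implicit Types (x y : R) (p : {poly R}).

Lemma exprn_le_expR k x : 0 <= x -> x ^+ k <= k`!%:R * expR x.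
Proof.
case: k => [|k] x0; first by rewrite expr0 mul1r -expR0 ler_expR.
have := expR_ge1Dxn k x0 => h.
rewrite mulrC -ler_pdivrMr ?ltr0n ?fact_gt0//; apply: le_trans h.
by rewrite lerDr.
Qed.

Lemma poly_expRN_bounded p k : exists C, forall y, 0 <= y ->
  y ^+ k * `|p.[y]| * expR (- y) <= C.
Proof.
elim/poly_ind: p k => [|p c ih] k.
  by exists 0 => y _; rewrite horner0 normr0 mulr0 mul0r.
have [C hC] := ih k.+1; exists (C + `|c| * k`!%:R) => y y0.
rewrite hornerMXaddC; apply: (@le_trans _ _
    (y ^+ k.+1 * `|p.[y]| * expR (- y) + `|c| * (y ^+ k * expR (- y)))).
  have -> : y ^+ k.+1 * `|p.[y]| * expR (- y) + `|c| * (y ^+ k * expR (- y)) =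
      y ^+ k * (`|p.[y]| * y + `|c|) * expR (- y) by rewrite exprS; ring.
  apply: ler_wpM2r; first exact: expR_ge0.
  apply: ler_wpM2l; first exact: exprn_ge0.
  by rewrite (le_trans (ler_normD _ _))// normrM (ger0_norm y0).
apply: lerD; first exact: hC.
apply: ler_wpM2l => //; rewrite expRN ler_pdivrMr ?expR_gt0//.
exact: exprn_le_expR.
Qed.

Lemma is_derive_inv x : x != 0 -> is_derive x 1 (fun y : R => y^-1) (- x ^- 2).
Proof.
move=> x0; apply: DeriveDef; first exact: (@derivableV _ _ id).
by rewrite (@deriveV _ _ id)// derive_id /GRing.scale/= mulr1.
Qed.

(** The polynomial factor makes this family stable under derivation, [p] becoming [X^2 (p - p')], so
    that smoothness is a plain induction. *)
Definition flat p x : R := if 0 < x then p.[x^-1] * expR (- x^-1) else 0.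

(** The square makes the difference quotient at 0 tend to 0. *)
Lemma flat_le_sqr p : exists2 C, 0 <= C & forall x, `|flat p x| <= C * x ^+ 2.
Proof.
have [C hC] := poly_expRN_bounded p 2.
have C0 : 0 <= C.
  by apply: le_trans (hC 0 (lexx _)); rewrite expr2 !mul0r.
exists C => // x; rewrite /flat; case: ifP => x0; last first.
  by rewrite normr0 mulr_ge0// sqr_ge0.
have := hC x^-1; rewrite invr_ge0 (ltW x0) => /(_ isT).
rewrite normrM (ger0_norm (expR_ge0 _)) exprVn -mulrA mulrC.
by rewrite ler_pdivrMr// exprn_gt0.
Qed.

Lemma is_derive_flat p x : is_derive x 1 (flat p) (flat ('X^2 * (p - p^`()%R)) x).
Proof.
have [x0|x0|->] := ltgtP x 0.
- rewrite [X in is_derive _ _ _ X]/flat ltNge (ltW x0)/=.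
  apply: (@near_eq_is_derive _ _ _ (cst 0)).
  near=> y; rewrite /flat ltNge (_ : y <= 0 = true)//.
  by apply: ltW; near: y; exact: lt_nbhsl.
- apply: (@near_eq_is_derive _ _ _ (fun x => p.[x^-1] * expR (- x^-1))).
    near=> y; rewrite /flat (_ : 0 < y = true)//.
    by near: y; exact: lt_nbhsr.
  have xn0 : x != 0 by rewrite gt_eqF.
  have dV := is_derive_inv xn0.
  have dNV : is_derive x 1 (fun y : R => - y^-1) (x ^- 2).
    by apply: (is_derive_eq (is_deriveN dV)); rewrite opprK.
  have dp := @is_derive1_comp R (horner p) (fun y => y^-1) x _ _ (is_derive_poly _ _) dV.
  have de := @is_derive1_comp R expR (fun y => - y^-1) x _ _ (is_derive_expR _) dNV.
  apply: (is_derive_eq (is_deriveM dp de)).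
  rewrite /flat x0 hornerM hornerXn hornerD hornerN exprVn /GRing.scale/=; ring.
rewrite [X in is_derive _ _ _ X]/flat ltxx.
have [C C0 hC] := flat_le_sqr p.
have cv : (fun h : R => h^-1 *: (flat p (h *: 1 + 0) - flat p 0)) @ 0^' --> (0 : R).
  apply/cvgrPdist_le => e e0; near=> h.
  have h0 : h != 0 by near: h; exact: nbhs_dnbhs_neq.
  rewrite {2}/flat ltxx subr0 addr0 /GRing.scale/= mulr1 sub0r normrN normrM normfV.
  rewrite mulrC ler_pdivrMr ?normr_gt0//; apply: (le_trans (hC h)).
  rewrite -normr_id -[h ^+ 2]real_normK ?num_real// expr2 mulrA normr_id.
  apply: ler_wpM2r => //.
  have hs : `|h| <= e / (C + 1).
    near: h; apply: dnbhs0_le; rewrite divr_gt0//; lra.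
  apply: (le_trans (ler_wpM2l C0 hs)); rewrite mulrCA ger_pMr//.
  rewrite ler_pdivrMr; lra.
by apply: DeriveDef; [apply/cvg_ex; exists 0; exact: cv|exact: cvg_lim cv].
Unshelve. all: by end_near. Qed.

Lemma flat_smooth p : rsmooth (flat p).
Proof.
apply/rsmoothP => n; elim: n p => // n ih p.
exact: (Cn_is_derive (is_derive_flat p)).
Qed.

Lemma flat1_gt0 x : 0 < x -> 0 < flat 1 x.
Proof. by move=> x0; rewrite /flat x0 hornerC mul1r expR_gt0. Qed.

Lemma flat1_ge0 x : 0 <= flat 1 x.
Proof. by rewrite /flat; case: ifP => // x0; rewrite hornerC mul1r expR_ge0. Qed.

Lemma flat_le0 p x : x <= 0 -> flat p x = 0.
Proof. by move=> x0; rewrite /flat ltNge x0. Qed.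

Let below x := flat 1 (1 * x + 1).
Let above x := flat 1 (-1 * x + (- 2^-1)).

(** A smooth step from 0 (up to -1) to 1 (from -1/2 on). The denominator is positive because the
    half-lines [x > -1] and [x < -1/2] cover the line. *)
Definition cutoff x : R := below x * (below x + above x)^-1.

Let sum_gt0 x : 0 < below x + above x.
Proof.
have [x1|x1] := ltP (-1) x.
  by apply: ltr_pwDl; [apply: flat1_gt0; lra|exact: flat1_ge0].
by apply: ltr_wpDl; [exact: flat1_ge0|apply: flat1_gt0; lra].
Qed.

Lemma cutoff_smooth : rsmooth cutoff.
Proof.
have sf : rsmooth (flat 1) by exact: flat_smooth.
have sb : rsmooth below by exact: rsmooth_affine sf.
have sa : rsmooth above by exact: rsmooth_affine sf.
apply: rsmoothM; first exact: sb.
have /rsmoothP cs := rsmoothD sb sa.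
by apply/rsmoothP => n; apply: CnV => // x; rewrite gt_eqF.
Qed.

Lemma cutoff_le x : x <= -1 -> cutoff x = 0.
Proof.
by move=> x1; rewrite /cutoff /below flat_le0 ?mul0r//; lra.
Qed.

Lemma cutoff_ge x : - 2^-1 <= x -> cutoff x = 1.
Proof.
move=> x1; rewrite /cutoff; have := sum_gt0 x.
have -> : above x = 0 by apply: flat_le0; lra.
by rewrite addr0 => b0; rewrite divff// gt_eqF.
Qed.

(** Outside [[-1, 0]] the cutoff is locally constant with value 0 or 1; on that segment its
    derivatives are continuous. *)
Lemma cutoff_derive1n_bounded m : exists2 K, 0 <= K &
  forall i x, (i <= m)%N -> `|derive1n i cutoff x| <= K.
Proof.
have bd i : exists2 K, 0 <= K & forall x, `|derive1n i cutoff x| <= K.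
  have cn : {within `[-1, 0], continuous (fun x => `|derive1n i cutoff x|)}.
    apply: continuous_subspaceT => x; apply: continuous_comp.
      by apply/differentiable_continuous/derivable1_diffP; exact: cutoff_smooth.
    exact: norm_continuous.
  have m10 : -1 <= 0 :> R by rewrite oppr_le0.
  have [c _ hc] := EVT_max m10 cn.
  exists (`|derive1n i cutoff c| + 1); first by rewrite addr_ge0.
  move=> x; have cst_le (k : R) : `|k| <= 1 -> `|derive1n i (fun=> k) x| <= 1.
    by case: i {cn hc} => [//|i] _; rewrite derive1n_cst normr0.
  have [x1|x1] := ltP x (-1).
    rewrite (@derive1n_local _ i `]-oo, -1[ _ (fun=> 0)) ?in_itv//=.
    - by rewrite (le_trans (cst_le 0 _)) ?normr0// lerDr.
    - by move=> z; rewrite in_itv/= => /ltW /cutoff_le.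
  have [x0|x0] := leP x 0.
    by rewrite (le_trans (hc x _)) ?lerDl// in_itv/= x1 x0.
  rewrite (@derive1n_local _ i `](- 2^-1), +oo[ _ (fun=> 1)) ?in_itv//= ?andbT.
  - by rewrite (le_trans (cst_le 1 _)) ?normr1// lerDr.
  - by move=> z; rewrite in_itv/= andbT => /ltW /cutoff_ge.
  - by rewrite in_itv/= andbT; lra.
elim: m => [|m [K K0 ih]].
  by have [K K0 hK] := bd 0; exists K => // i x; rewrite leqn0 => /eqP ->.
have [K' K'0 hK'] := bd m.+1; exists (K + K'); first exact: addr_ge0.
move=> i x; rewrite leq_eqVlt => /orP[/eqP ->|].
  by rewrite (le_trans (hK' x))// lerDr.
by rewrite ltnS => im; rewrite (le_trans (ih _ _ im))// lerDl.
Qed.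

End Cutoff.

(** * Bernstein approximation of Lipschitz functions *)

Section Bernstein.
Context {R : realType}.
Implicit Types (x a b c : R) (f g : nat -> R).

(* [bernstein n f] evaluated at x is the expectation of f at a binomial
   variable with parameters n and x, computed by conditioning on one trial. *)
Fixpoint bernstein n f : {poly R} :=
  if n is m.+1 then 'X * bernstein m (fun k => f k.+1) + (1 - 'X) * bernstein m f
  else (f 0)%:P.

Lemma bernsteinS n f x : (bernstein n.+1 f).[x] =
  x * (bernstein n (fun k => f k.+1)).[x] + (1 - x) * (bernstein n f).[x].
Proof. by rewrite /= !hornerE. Qed.

(** Second moment of the binomial variable about [b]: variance plus squared bias. The point [b] is
    left free because a success in the trial shifts it to [b - 1]. *)
Lemma bernstein_quadratic n a b c x :
  (bernstein n (fun k => a + c * (k%:R - b) ^+ 2)).[x] =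
  a + c * (n%:R * x * (1 - x) + (n%:R * x - b) ^+ 2).
Proof.
elim: n b => [|n ih] b; first by rewrite /= hornerC; ring.
have natS (k : nat) : k.+1%:R = k%:R + 1 :> R by rewrite natr1.
rewrite bernsteinS ih (_ : (fun k => _) = fun k => a + c * (k%:R - (b - 1)) ^+ 2).
  by rewrite ih natS; ring.
by apply/funext => k; rewrite natS; ring.
Qed.

Lemma bernstein_le n f g x : 0 <= x <= 1 ->
  (forall k, (k <= n)%N -> f k <= g k) -> (bernstein n f).[x] <= (bernstein n g).[x].
Proof.
move=> /andP[x0 x1]; elim: n f g => [|n ih] f g fg.
  by rewrite /= !hornerC; exact: fg.
rewrite !bernsteinS lerD// ler_wpM2l ?subr_ge0//; apply: ih => k kn; apply: fg => //.
exact: leqW.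
Qed.

(** Young's inequality [L d <= e/2 + L^2 d^2 / (2 e)] bounds the deviation of [h] by a quadratic in
    [k], whose Bernstein polynomial is explicit; its variance term is at most [e/2] as soon as
    [n > L^2 / e^2]. *)
Lemma lipschitz_poly_approx (h : R -> R) (L e : R) : 0 < e ->
  (forall x y, 0 <= x <= 1 -> 0 <= y <= 1 -> `|h x - h y| <= L * `|x - y|) ->
  exists P : {poly R}, forall x, 0 <= x <= 1 -> `|P.[x] - h x| <= e.
Proof.
move=> e0 hL; pose n := (Num.truncn (L ^+ 2 / e ^+ 2)).+1.
have n0 : 0 < n%:R :> R by [].
pose f k := h (k%:R / n%:R); exists (bernstein n f) => x x01.
pose c := L ^+ 2 / (2 * e * n%:R ^+ 2).
have fk k : (k <= n)%N -> `|f k - h x| <= e / 2 + c * (k%:R - n%:R * x) ^+ 2.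
  move=> kn; apply: (le_trans (hL _ _ _ x01)).
    by rewrite divr_ge0//= ler_pdivrMr// mul1r ler_nat.
  set d := `|_|; have dE : (k%:R - n%:R * x) ^+ 2 = n%:R ^+ 2 * d ^+ 2.
    by rewrite /d real_normK ?num_real//; field; rewrite gt_eqF.
  rewrite dE -subr_ge0 (_ : _ - _ = (e - L * d) ^+ 2 / (2 * e)); last first.
    by rewrite /c; field; rewrite !gt_eqF.
  by rewrite divr_ge0 ?sqr_ge0// mulr_ge0// ltW.
have cn : c * (n%:R * x * (1 - x)) <= e / 2.
  have hn : L ^+ 2 / e ^+ 2 <= n%:R by apply: ltW; exact: truncnS_gt.
  have /andP[x0 x1] := x01.
  have xx : x * (1 - x) <= 1 by nra.
  have -> : c * (n%:R * x * (1 - x)) =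
      (L ^+ 2 / e ^+ 2) / n%:R * (x * (1 - x)) * (e / 2).
    by rewrite /c; field; rewrite !gt_eqF.
  have h1 : (L ^+ 2 / e ^+ 2) / n%:R <= 1 by rewrite ler_pdivrMr// mul1r.
  have h0 : 0 <= (L ^+ 2 / e ^+ 2) / n%:R.
    by rewrite !divr_ge0 ?sqr_ge0// ltW.
  rewrite ler_piMl ?divr_ge0 ?(ltW e0)//.
  by rewrite (le_trans _ h1)// ler_piMr.
have quad s a : (bernstein n (fun k => a + s * (k%:R - n%:R * x) ^+ 2)).[x] =
    a + s * (n%:R * x * (1 - x)).
  by rewrite bernstein_quadratic subrr expr0n/= addr0.
rewrite ler_distl; apply/andP; split.
  apply: (@le_trans _ _ (h x - e / 2 + - c * (n%:R * x * (1 - x)))); first lra.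
  rewrite -quad; apply: bernstein_le => // k kn.
  by have := fk k kn; rewrite ler_distl => /andP[? _]; lra.
apply: (@le_trans _ _ (h x + e / 2 + c * (n%:R * x * (1 - x)))); last lra.
rewrite -quad; apply: bernstein_le => // k kn.
by have := fk k kn; rewrite ler_distl => /andP[_ ?]; lra.
Qed.

End Bernstein.

(** * Exponential sums and their decay *)

Section ExponentialSums.
Context {R : realType}.
Implicit Types (t x y e : R) (a : nat -> R) (u d : R -> R).

(** Frequencies start at 1: the transform is given only for [Re s > s1], and each sum is then
    [O(e^(-t))] at +oo. *)
Definition expsum N a t : R := \sum_(i < N) a i * expR (- i.+1%:R * t).

Lemma is_derive_expsum N a t :
  is_derive t 1 (expsum N a) (expsum N (fun i => a i * - i.+1%:R) t).
Proof.
rewrite (_ : expsum N a = \sum_(i < N) (a i \*: (fun t => expR (- i.+1%:R * t)))).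
  have ds (i : 'I_N) : is_derive t 1 (a i \*: (fun t => expR (- i.+1%:R * t)))
      (a i * (- i.+1%:R * expR (- i.+1%:R * t))).
    by have de := is_derive_exp (- i.+1%:R) t; exact: is_deriveZ.
  apply: (is_derive_eq (is_derive_sum ds)).
  by apply: eq_bigr => i _; rewrite mulrA.
by apply/funext => x; rewrite /expsum fct_sumE.
Qed.

Lemma rsmooth_expsum N a : rsmooth (expsum N a).
Proof.
apply/rsmoothP => n; elim: n a => // n ih a.
exact: (Cn_is_derive (is_derive_expsum N a)).
Qed.

Lemma expsum_le N a t : 0 <= t ->
  `|expsum N a t| <= (\sum_(i < N) `|a i|) * expR (- t).
Proof.
move=> t0; rewrite (le_trans (ler_norm_sum _ _ _))// big_distrl/= ler_sum// => i _.
rewrite normrM ler_wpM2l// ger0_norm ?expR_ge0// ler_expR.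
have : t <= i.+1%:R * t by rewrite ler_peMl// ler1n.
lra.
Qed.

(* Integrate from +oo: the bound on d' is inherited by d because d vanishes at
   infinity, whatever the constant A. *)
Lemma exp_decay_primitive (d d' : R -> R) e A K : (forall t, is_derive t 1 d (d' t)) ->
  (forall t, -1 <= t -> `|d' t| <= e * expR (- t)) ->
  (forall t, K <= t -> `|d t| <= A * expR (- t)) ->
  forall t, -1 <= t -> `|d t| <= e * expR (- t).
Proof.
have half (g g' : R -> R) : (forall t, is_derive t 1 g (g' t)) ->
    (forall t, -1 <= t -> `|g' t| <= e * expR (- t)) ->
    (forall t, K <= t -> `|g t| <= A * expR (- t)) ->
    forall t, -1 <= t -> g t <= e * expR (- t).
  move=> dg hg' hg t t1; pose h s := e * expR (- s) - g s.
  have deE (s : R) : is_derive s 1 (fun s : R => expR (- s)) (- expR (- s)).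
    have dN : is_derive s 1 (@GRing.opp R) (- 1) by exact: is_deriveNid.
    have := @is_derive1_comp R expR -%R s _ _ (is_derive_expR _) dN.
    by rewrite mulrN1.
  have dh (s : R) : is_derive s 1 h (- (e * expR (- s)) - g' s).
    have := is_deriveB (is_deriveZ e (deE s)) (dg s).
    by rewrite /GRing.scale/= mulrN.
  have hmono s : t <= s -> h s <= h t.
    move=> ts; apply: (@ler0_derive1_nincry _ h (-1)) => //.
    - move=> x; rewrite in_itv/= andbT => x1; rewrite derive1E; have [_ ->] := dh x.
      by have := hg' x (ltW x1); rewrite ler_norml => /andP[? _]; lra.
    - exact: continuous_subspaceT (is_derive_continuous dh).
  rewrite -subr_ge0 -/(h t) leNgt; apply/negP => ht.
  have A0 : 0 <= A.
    have := hg K (lexx _); have := normr_ge0 (g K).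
    by move=> /le_trans /[apply]; rewrite pmulr_lge0// expR_gt0.
  (* If [h t < 0], monotonicity gives [g s >= - h t > 0] for all [s >= t]; this [s] is so large that
     [g s <= A e^(-s) <= A / s < - h t]. *)
  pose s := Num.max t (Num.max K (Num.max 1 (A / - h t + 1))).
  have [ts Ks s1 sA] : [/\ t <= s, K <= s, 1 <= s & A / - h t + 1 <= s].
    by rewrite /s; split; rewrite !le_max lexx ?orbT.
  have s0 : 0 < s := lt_le_trans ltr01 s1.
  have : `|g s| <= A / s.
    rewrite (le_trans (hg s Ks))// ler_wpM2l// expRN lef_pV2 ?posrE ?expR_gt0//.
    by rewrite (le_trans _ (expR_ge1Dx s))// lerDr.
  rewrite ler_norml => /andP[_ gs].
  have := hmono s ts; rewrite /h -/(h t).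
  have : 0 <= e * expR (- s).
    by apply: le_trans (hg' s _) => //; lra.
  have : A / s < - h t.
    rewrite ltr_pdivrMr// mulrC -ltr_pdivrMr; lra.
  by lra.
move=> dd hd' hd t t1; rewrite ler_norml lerNl; apply/andP; split.
  apply: (half (fun x => - d x) (fun x => - d' x)) => // s.
  - by rewrite normrN; exact: hd'.
  - by rewrite normrN; exact: hd.
exact: half hd' hd t t1.
Qed.

End ExponentialSums.

(** * Weighted approximation of test functions by exponential sums *)

Section ExponentialApproximation.
Context {R : realType}.
Implicit Types (t x y e K : R) (u : R -> R).

Lemma segment_bounded u x y : continuous u ->
  exists2 M, 0 <= M & forall z, x <= z <= y -> `|u z| <= M.
Proof.
move=> cu; have [xy|yx] := leP x y; last first.
  by exists 0 => // z /andP[xz /(le_trans xz)]; rewrite leNgt yx.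
have cn : {within `[x, y], continuous (fun z => `|u z|)}.
  apply: continuous_subspaceT => z; apply: continuous_comp; first exact: cu.
  exact: norm_continuous.
have [c _ hc] := EVT_max xy cn; exists `|u c|; first exact: normr_ge0.
by move=> z zxy; apply: hc; rewrite in_itv.
Qed.

(* In the variable w = e^(-(t + 1)), which maps [-1, +oo[ onto ]0, 1], sums of
   e^(-n t), n >= 1, are w P(w) with P a polynomial; dividing u by w as well
   makes the error of a uniform approximation on [0, 1] relative to e^(-t). *)
Lemma log_pullback_lipschitz u K : rsmooth u -> (forall t, K < t -> u t = 0) ->
  exists L, forall x y, 0 <= x <= 1 -> 0 <= y <= 1 ->
    `|u (- ln x - 1) / x - u (- ln y - 1) / y| <= L * `|x - y|.
Proof.
move=> su uK; pose K' := Num.max K 0.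
have K0 : 0 <= K' by rewrite /K' le_max lexx orbT.
have uK' t : K' < t -> u t = 0.
  by move=> Kt; apply: uK; apply: le_lt_trans Kt; rewrite /K' le_max lexx.
(* For [0 < x <= w0] the argument [- ln x - 1] is at least [K' + 1], so [g] vanishes and the
   singular factor [1/x] only matters on [[w0, 1]]; at 0 the convention [0^-1 = 0] agrees with
   this. *)
pose w0 := expR (- (K' + 2)); have w00 : 0 < w0 by exact: expR_gt0.
pose g x := u (- ln x - 1) * x^-1.
have [M0 M00 hM0] := @segment_bounded u (-1) (K' + 1) (rsmooth_continuous su).
have su' := rsmooth_derive su.
have [M1 M10 hM1] := @segment_bounded _ (-1) (K' + 1) (rsmooth_continuous su').
pose dg x := - (u^`()%classic (- ln x - 1) + u (- ln x - 1)) * x^-1 ^+ 2.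
have gd x : 0 < x -> is_derive x 1 g (dg x).
  move=> x0; have dl := is_derive1_ln x0.
  have dl' : is_derive x 1 (fun x => - ln x - 1) (- x^-1).
    by apply: is_derive_eq; rewrite subr0.
  have du := @is_derive1_comp R u (fun x => - ln x - 1) x _ _
    (rsmooth_is_derive _ su) dl'.
  have xn0 : x != 0 by rewrite gt_eqF.
  have dV := is_derive_inv xn0.
  apply: (is_derive_eq (is_deriveM du dV)).
  by rewrite /dg /GRing.scale/= exprVn; field; rewrite gt_eqF.
have g_small x : 0 <= x -> x <= w0 -> g x = 0.
  rewrite le_eqVlt => /predU1P[<- _|x0 xw]; first by rewrite /g invr0 mulr0.
  rewrite /g uK' ?mul0r//.
  have : ln x <= - (K' + 2) by rewrite -(expRK (- (K' + 2))) ler_ln ?posrE.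
  lra.
pose L := (M0 + M1) * w0^-1 ^+ 2.
have L0 : 0 <= L by rewrite mulr_ge0 ?addr_ge0// sqr_ge0.
have mvt x y : w0 <= x -> x <= y -> y <= 1 -> `|g y - g x| <= L * (y - x).
  move=> wx xy y1.
  have gd' z : z \in `]x, y[ -> is_derive z 1 g (dg z).
    rewrite in_itv/= => /andP[xz _]; apply: gd.
    exact: lt_trans (lt_le_trans w00 wx) xz.
  have cg : {within `[x, y], continuous g}.
    apply: derivable_within_continuous => z; rewrite in_itv/= => /andP[xz _].
    by have [] := gd z (lt_le_trans (lt_le_trans w00 wx) xz).
  have [c + ->] := MVT_segment xy gd' cg.
  rewrite in_itv/= => /andP[xc cy]; rewrite normrM (ger0_norm (x := y - x)) ?subr_ge0//.
  apply: ler_wpM2r; first by rewrite subr_ge0.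
  have wc : w0 <= c := le_trans wx xc; have c0 : 0 < c := lt_le_trans w00 wc.
  rewrite /dg normrM normrN /L; apply: ler_pM => //.
    rewrite (le_trans (ler_normD _ _))// addrC.
    have lc : -1 <= - ln c - 1.
      have : ln c <= 0 by rewrite ln_le0// (le_trans cy).
      lra.
    have [cK|cK] := leP (- ln c - 1) (K' + 1).
      by rewrite lerD// ?hM0 ?hM1// lc cK.
    have : - (K' + 2) <= ln c by rewrite -(expRK (- (K' + 2))) ler_ln ?posrE.
    lra.
  rewrite ger0_norm ?sqr_ge0// lerXn2r// ?nnegrE ?invr_ge0 ?(ltW c0) ?(ltW w00)//.
  by rewrite lef_pV2 ?posrE.
have w01 : w0 <= 1 by rewrite /w0 expR_le1; lra.
have main x y : 0 <= x -> x <= y -> y <= 1 -> `|g y - g x| <= L * (y - x).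
  move=> x0 xy y1; have [wx|xw] := leP w0 x; first exact: mvt.
  rewrite (g_small x x0 (ltW xw)); have [wy|yw] := leP w0 y; last first.
    rewrite (g_small y (le_trans x0 xy) (ltW yw)) subrr normr0 mulr_ge0// subr_ge0//.
  rewrite -(g_small w0 (ltW w00) (lexx _)) (le_trans (mvt _ _ (lexx _) wy y1))//.
  by rewrite ler_wpM2l// lerD2l lerN2 ltW.
exists L => x y /andP[x0 x1] /andP[y0 y1]; rewrite -/(g x) -/(g y).
have [xy|yx] := leP x y.
  by rewrite distrC (distrC x) (ger0_norm (x := y - x)) ?subr_ge0// main.
by rewrite (ger0_norm (x := x - y)) ?subr_ge0 ?main// ltW.
Qed.

Lemma expsum_approx0 u K e : rsmooth u -> (forall t, K < t -> u t = 0) -> 0 < e ->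
  exists N a, forall t, -1 <= t -> `|u t + expsum N a t| <= e * expR (- t).
Proof.
move=> su uK e0; have [L hL] := log_pullback_lipschitz su uK.
have [P hP] := lipschitz_poly_approx e0 hL.
(* The expansion of [- w P(w)] with [w = e^(-(t + 1))]: the shift by 1 goes into the coefficients,
   and the sign makes [u + expsum] the error. *)
exists (size P), (fun i => - P`_i * expR (- i.+1%:R)) => t t1.
pose w := expR (- (t + 1)); have w0 : 0 < w by exact: expR_gt0.
have w1 : w <= 1 by rewrite /w expR_le1; lra.
have := hP w; rewrite (ltW w0) w1 => /(_ isT).
have -> : - ln w - 1 = t by rewrite /w expRK; ring.
have -> : expsum (size P) (fun i => - P`_i * expR (- i.+1%:R)) t = - (w * P.[w]).
  rewrite /expsum horner_coef big_distrr/= -sumrN; apply: eq_bigr => i _.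
  have -> : w * (P`_i * w ^+ i) = P`_i * expR (i.+1%:R * - (t + 1)).
    by rewrite mulrCA -exprS expRM_natl.
  rewrite -mulrA -expRD.
  have -> : - i.+1%:R + - i.+1%:R * t = i.+1%:R * - (t + 1) :> R by ring.
  by rewrite mulNr.
move=> h; have -> : u t - w * P.[w] = - (w * (P.[w] - u t / w)).
  by field; rewrite gt_eqF.
rewrite normrN normrM (ger0_norm (ltW w0)) mulrC.
apply: (@le_trans _ _ (e * w)); first by rewrite ler_wpM2r// ltW.
by rewrite ler_wpM2l ?(ltW e0)// ler_expR; lra.
Qed.

(** Induction through the derivative: approximate [u'], integrate the sum term by term, and carry
    the same bound to the primitive by [exp_decay_primitive]. The decay this requires is that of the
    sum alone, [u] being 0 far out. *)
Lemma expsum_approx m u K e : rsmooth u -> (forall t, K < t -> u t = 0) -> 0 < e ->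
  exists N a, forall j t, (j <= m)%N -> -1 <= t ->
    `|derive1n j (fun t => u t + expsum N a t) t| <= e * expR (- t).
Proof.
move=> + + e0; elim: m u => [|m ih] u su uK.
  have [N [a ha]] := expsum_approx0 su uK e0; exists N, a => j t.
  by rewrite leqn0 => /eqP -> /ha.
have uK' t : K < t -> u^`()%classic t = 0.
  move=> Kt; rewrite -[LHS]/(derive1n 1 u t).
  rewrite (@derive1n_local _ 1 `]K, +oo[%classic _ (fun=> 0)).
  - exact: derive1n_cst 0 _ _.
  - exact: interval_open.
  - by move=> z; rewrite /= in_itv/= andbT; exact: uK.
  - by rewrite /= in_itv/= andbT.
have [N [a ha]] := ih _ (rsmooth_derive su) uK'.
pose b i := a i * - i.+1%:R^-1; exists N, b.
have dsum t : is_derive t 1 (expsum N b) (expsum N a t).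
  have := is_derive_expsum N b t.
  rewrite (_ : (fun i => b i * - i.+1%:R) = a)//; apply/funext => i.
  by rewrite /b; field.
have dd t : is_derive t 1 (fun t => u t + expsum N b t) (u^`()%classic t + expsum N a t).
  have := rsmooth_is_derive t su; have := dsum t => ? ?; exact: is_deriveD.
move=> [|j] t; last by move=> jm t1; rewrite derive1Sn (derive1_eq dd); exact: ha.
move=> _; move: t; apply: (exp_decay_primitive dd (fun t => ha 0 t isT)
  (K := Num.max (K + 1) 0) (A := \sum_(i < N) `|b i|)) => t.
rewrite ge_max => /andP[Kt t0]; rewrite uK ?add0r; first exact: expsum_le.
lra.
Qed.

End ExponentialApproximation.

(** * Real test and Schwartz functions, and the seminorms of products with the cutoff *)

Section RealTestFunctions.
Context {R : realType}.
Implicit Types (u v d : R -> R) (x t K C : R) (psi : R -> R[i]).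

Definition rtest u := rsmooth u /\ exists K, forall x, K < `|x| -> u x = 0.

Definition rschwartz u := rsmooth u /\
  forall l n, exists M, forall x, `|x| ^+ l * `|derive1n n u x| <= M.

Local Notation cplx u := (fun x => (u x)%:C).

Lemma derive1n_cst0 n x : derive1n n (fun=> 0 : R) x = 0.
Proof. by case: n => // n; exact: derive1n_cst. Qed.

Lemma normc_cderiven u n x : Normc.normc (cderiven n (cplx u) x) = `|derive1n n u x|.
Proof. by rewrite /cderiven /= derive1n_cst0 expr0n addr0 sqrtr_sqr. Qed.

Lemma Re_le_normc (z : R[i]) : `|complex.Re z| <= Normc.normc z.
Proof.
case: z => a b /=; rewrite -sqrtr_sqr ler_sqrt ?addr_ge0 ?sqr_ge0//.
by rewrite lerDl sqr_ge0.
Qed.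

Lemma Im_le_normc (z : R[i]) : `|complex.Im z| <= Normc.normc z.
Proof.
case: z => a b /=; rewrite -sqrtr_sqr ler_sqrt ?addr_ge0 ?sqr_ge0//.
by rewrite lerDr sqr_ge0.
Qed.

Lemma rsmooth_smooth u : rsmooth u -> smooth (cplx u).
Proof. by move=> su n x; split; [exact: su|exact: rsmooth_cst]. Qed.

Lemma rtest_test u : rtest u -> test_function (cplx u).
Proof.
move=> [su [K hK]]; split; first exact: rsmooth_smooth.
by exists K => x /hK ->.
Qed.

Lemma test_parts psi : test_function psi ->
  rtest (fun x => complex.Re (psi x)) /\ rtest (fun x => complex.Im (psi x)).
Proof.
move=> [sp [K hK]]; split; split; do ?[by move=> n x; have [] := sp n x];
  by exists K => x /hK ->.
Qed.

Lemma rschwartz_schwartz u : rschwartz u -> schwartz_function (cplx u).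
Proof.
move=> [su hu]; split; first exact: rsmooth_smooth.
by move=> l n; have [M hM] := hu l n; exists M => x; rewrite normc_cderiven.
Qed.

Lemma schwartz_parts psi : schwartz_function psi ->
  rschwartz (fun x => complex.Re (psi x)) /\ rschwartz (fun x => complex.Im (psi x)).
Proof.
move=> [sp hp]; split; split; do ?[by move=> n x; have [] := sp n x].
  move=> l n; have [M hM] := hp l n; exists M => x; apply: le_trans (hM x).
  by rewrite ler_wpM2l ?exprn_ge0//; exact: (Re_le_normc (cderiven n psi x)).
move=> l n; have [M hM] := hp l n; exists M => x; apply: le_trans (hM x).
by rewrite ler_wpM2l ?exprn_ge0//; exact: (Im_le_normc (cderiven n psi x)).
Qed.

Lemma rschwartz_lin c u v : rschwartz u -> rschwartz v ->
  rschwartz (fun x => c * u x + v x).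
Proof.
move=> [su hu] [sv hv]; have scu : rsmooth (fun x => c * u x) by exact: rsmoothZ.
split; first exact: rsmoothD scu sv.
move=> l n; have [M hM] := hu l n; have [M' hM'] := hv l n.
exists (`|c| * M + M') => x; rewrite (derive1nD n scu sv) (derive1nZ n c su).
apply: (@le_trans _ _ (`|x| ^+ l * (`|c| * `|derive1n n u x| + `|derive1n n v x|))).
  by rewrite ler_wpM2l ?exprn_ge0// (le_trans (ler_normD _ _))// normrM.
rewrite mulrDr mulrCA lerD//.
by rewrite ler_wpM2l.
Qed.

Lemma derive1n_vanish u (D : set R) n : open D -> (forall x, D x -> u x = 0) ->
  forall x, D x -> derive1n n u x = 0.
Proof.
by move=> oD h x Dx; rewrite (derive1n_local n oD h Dx) derive1n_cst0.
Qed.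

Lemma rtest_derive1n_bounded u n : rtest u ->
  exists2 M, 0 <= M & forall x, `|derive1n n u x| <= M.
Proof.
move=> [su [K hK]]; have cu : continuous (derive1n n u).
  by move=> x; apply/differentiable_continuous/derivable1_diffP; exact: su.
have [M M0 hM] := @segment_bounded _ _ (- K) K cu; exists M => // x.
have [xK|xK] := leP `|x| K; first by apply: hM; rewrite -ler_norml.
have [x0|x0] := leP 0 x.
  rewrite (@derive1n_vanish _ `]K, +oo[ n) ?normr0//=.
  - by move=> z; rewrite in_itv/= andbT => /lt_le_trans h; apply/hK/h; exact: ler_norm.
  - by rewrite in_itv/= andbT; rewrite ger0_norm in xK.
rewrite (@derive1n_vanish _ `]-oo, (- K)[ n) ?normr0//=.
- move=> z; rewrite in_itv/= => h; apply: hK; rewrite -normrN.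
  by apply: lt_le_trans (ler_norm _); rewrite ltrNr.
- by rewrite in_itv/= ltrNr; rewrite ltr0_norm in xK.
Qed.

Lemma open_norm_gt K : open [set x : R | K < `|x|].
Proof.
rewrite (_ : [set x | _] = [eta Num.Def.normr] @^-1` [set y : R | K < y])//.
by apply: open_comp; [move=> z _; exact: norm_continuous|exact: open_gt].
Qed.

Lemma rtest_rschwartz u : rtest u -> rschwartz u.
Proof.
move=> tu; have [su [K hK]] := tu; split => // l n.
have [M M0 hM] := rtest_derive1n_bounded n tu.
pose K' := Num.max K 0.
exists (K' ^+ l * M) => x; have [xK|xK] := leP `|x| K'.
  by rewrite ler_pM ?exprn_ge0// lerXn2r// nnegrE// (le_trans _ xK).
rewrite (derive1n_vanish n (@open_norm_gt K')) ?normr0 ?mulr0 ?mulr_ge0 ?exprn_ge0//.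
- by rewrite /K' le_max lexx orbT.
- by move=> z Kz; apply: hK; apply: le_lt_trans Kz; rewrite /K' le_max lexx.
Qed.

Lemma exprn_expRN_le l x : -1 <= x -> `|x| ^+ l * expR (- x) <= l`!%:R + expR 1.
Proof.
move=> x1; have [x0|x0] := leP 0 x.
  rewrite ger0_norm// expRN ler_pdivrMr ?expR_gt0//.
  apply: (le_trans (exprn_le_expR l x0)); rewrite ler_wpM2r ?expR_ge0//.
  by rewrite lerDl expR_ge0.
apply: (@le_trans _ _ (1 * expR 1)); last by rewrite mul1r lerDr.
rewrite ler_pM ?exprn_ge0 ?expR_ge0//.
  by rewrite exprn_ile1// ler0_norm ?(ltW x0)//; lra.
by rewrite ler_expR; lra.
Qed.

(** [B] depends on [m] alone, so an error [C e^(-t)] on [[-1, +oo[] becomes, after the cutoff, an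
    error [O(C)] in the seminorms seen by [T]. The weight [e^(-t)] pays for the powers of [|x|]. *)
Lemma cutoff_mul_bound m : exists2 B, 0 <= B & forall d C, rsmooth d -> 0 <= C ->
  (forall j t, (j <= m)%N -> -1 <= t -> `|derive1n j d t| <= C * expR (- t)) ->
  forall l n x, (l <= m)%N -> (n <= m)%N ->
    `|x| ^+ l * `|derive1n n (fun x => cutoff x * d x) x| <= B * C.
Proof.
have [K K0 hK] := @cutoff_derive1n_bounded R m.
have E0 : 0 <= m`!%:R + expR 1 :> R by rewrite addr_ge0// expR_ge0.
exists (2 ^+ m * K * (m`!%:R + expR 1)).
  by rewrite !mulr_ge0// exprn_ge0.
move=> d C sd C0 hd l n x lm nm; have [x1|x1] := leP (-1) x; last first.
  rewrite (@derive1n_vanish _ `]-oo, (-1)[ n) ?normr0 ?mulr0//=.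
  - by rewrite !mulr_ge0// exprn_ge0.
  - by move=> z; rewrite in_itv/= => z1; rewrite cutoff_le ?mul0r// ltW.
have Ce0 : 0 <= C * expR (- x) by rewrite mulr_ge0// expR_ge0.
have h := @derive1nM_le _ n cutoff d x K (C * expR (- x)) (@cutoff_smooth R) sd K0 Ce0
  (fun i iN => hK i x (leq_trans iN nm)) (fun i iN => hd i x (leq_trans iN nm) x1).
apply: (@le_trans _ _ (`|x| ^+ l * (2 ^+ n * K * (C * expR (- x))))).
  by rewrite ler_wpM2l// exprn_ge0.
have -> : `|x| ^+ l * (2 ^+ n * K * (C * expR (- x))) =
  2 ^+ n * (K * C * (`|x| ^+ l * expR (- x))) by ring.
have -> : 2 ^+ m * K * (m`!%:R + expR 1) * C =
  2 ^+ m * (K * C * (m`!%:R + expR 1)) by ring.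
apply: ler_pM.
- by rewrite exprn_ge0.
- by rewrite !mulr_ge0// ?expR_ge0 ?exprn_ge0.
- by rewrite ler_weXn2l// ler1n.
rewrite ler_wpM2l ?mulr_ge0//; apply: (le_trans (exprn_expRN_le l x1)).
by rewrite lerD2r ler_nat leq_fact.
Qed.

Lemma cutoff_mul_rschwartz d : rsmooth d ->
  (forall j, exists C, forall t, -1 <= t -> `|derive1n j d t| <= C * expR (- t)) ->
  rschwartz (fun x => cutoff x * d x).
Proof.
move=> sd hd; split; first exact: rsmoothM (@cutoff_smooth R) sd.
move=> l n; pose m := maxn l n.
have [C C0 hC] : exists2 C, 0 <= C &
    forall j t, (j <= m)%N -> -1 <= t -> `|derive1n j d t| <= C * expR (- t).
  elim: m => [|m [C C0 ih]].
    have [C hC] := hd 0; exists `|C| => // j t; rewrite leqn0 => /eqP -> t1.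
    by rewrite (le_trans (hC t t1))// ler_wpM2r ?expR_ge0// ler_norm.
  have [C' hC'] := hd m.+1; exists (C + `|C'|); first by rewrite addr_ge0.
  move=> j t; rewrite leq_eqVlt ltnS => /orP[/eqP ->|jm] t1.
    rewrite (le_trans (hC' t t1))// ler_wpM2r ?expR_ge0//.
    by rewrite (le_trans (ler_norm _))// lerDr.
  by rewrite (le_trans (ih j t jm t1))// ler_wpM2r ?expR_ge0// lerDl.
have [B B0 hB] := cutoff_mul_bound m; exists (B * C) => x.
by apply: hB => //; [exact: leq_maxl|exact: leq_maxr].
Qed.

End RealTestFunctions.

(** * Support of the tempered extension *)

Section TemperedDistributions.
Context {R : realType}.
Implicit Types (u v w : R -> R) (x t K C : R) (psi : R -> R[i]).
Local Notation cplx u := (fun x => (u x)%:C).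

Lemma rschwartz_uniform m u : rschwartz u -> exists2 M, 0 <= M &
  forall l n x, (l <= m)%N -> (n <= m)%N -> `|x| ^+ l * `|derive1n n u x| <= M.
Proof.
move=> [su hu]; have [M hM] := choice (fun ln : nat * nat => hu ln.1 ln.2).
pose S := \sum_(l < m.+1) \sum_(n < m.+1) `|M (nat_of_ord l, nat_of_ord n)|.
exists S => [|l n x lm nm]; first by rewrite sumr_ge0// => i _; rewrite sumr_ge0.
apply: (le_trans (hM (l, n) x)); apply: (le_trans (ler_norm _)).
have lm' : (l < m.+1)%N by []; have nm' : (n < m.+1)%N by [].
rewrite /S (bigD1 (Ordinal lm'))//= (bigD1 (Ordinal nm'))//= -addrA lerDl.
by rewrite addr_ge0 ?sumr_ge0// => i _; rewrite sumr_ge0.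
Qed.

Lemma rtestM u v : rsmooth u -> rtest v -> rtest (fun x => u x * v x).
Proof.
move=> su [sv [K hK]]; split; first exact: rsmoothM su sv.
by exists K => x /hK ->; rewrite mulr0.
Qed.

Lemma rsmooth_shift c u : rsmooth u -> rsmooth (fun x => u (x + c)).
Proof.
move=> su; have := @rsmooth_affine R 1 c u su.
by rewrite (_ : (fun x => u (1 * x + c)) = fun x => u (x + c))//;
  apply/funext => x; rewrite mul1r.
Qed.

Variables (p T : (R -> R[i]) -> R[i]) (s1 : R).
Hypothesis supp_p : supported_nonneg p.
Hypothesis temp_T : is_tempered_distribution T.
Hypothesis T_p : forall psi, test_function psi ->
  T psi = p (fun t => (expR (- (s1 * t)))%:C * psi t).

Lemma tempered_lin (c : R) u v : rschwartz u -> rschwartz v ->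
  T (cplx (fun x => c * u x + v x)) = c%:C * T (cplx u) + T (cplx v).
Proof.
move=> su sv; have [lin _] := temp_T.
rewrite -(lin c%:C _ _ (rschwartz_schwartz su) (rschwartz_schwartz sv)).
by congr T; apply/funext => x; rewrite rmorphD rmorphM.
Qed.

Lemma tempered_bound : exists m, exists2 C, 0 <= C & forall u B, rschwartz u ->
  (forall l n x, (l <= m)%N -> (n <= m)%N -> `|x| ^+ l * `|derive1n n u x| <= B) ->
  Normc.normc (T (cplx u)) <= C * B.
Proof.
have [_ [m [C hC]]] := temp_T; exists m; exists `|C| => // u B su hB.
have B0 : 0 <= B by apply: le_trans (hB 0%N 0%N 0 _ _) => //; rewrite mul1r.
apply: (@le_trans _ _ (C * B)); last by rewrite ler_wpM2r// ler_norm.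
apply: hC; first exact: rschwartz_schwartz.
by move=> l n x lm nm; rewrite normc_cderiven; exact: hB.
Qed.

Lemma tempered_test u e : rtest u -> 0 < e -> (forall x, - e < x -> u x = 0) ->
  T (cplx u) = 0.
Proof.
move=> tu e0 ue; rewrite T_p; last exact: rtest_test.
have te : rtest (fun t => expR (- s1 * t) * u t).
  by apply: rtestM => //; exact: rsmooth_exp.
rewrite -[LHS](_ : p (cplx (fun t => expR (- s1 * t) * u t)) = _); last first.
  by congr p; apply/funext => t; rewrite rmorphM mulNr.
apply: supp_p; first exact: rtest_test.
by exists e => // x /ue ->; rewrite mulr0.
Qed.

(* Cut v off at -r: the truncated function is a test function killed by T, and
   the seminorms of the remainder, which lives on ]-oo, -r], are O(1 / r). *)
Lemma tempered_vanish v e : rschwartz v -> 0 < e -> (forall x, - e < x -> v x = 0) ->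
  T (cplx v) = 0.
Proof.
move=> hv e0 ve; have [sv _] := hv.
have [m [C C0 hC]] := tempered_bound.
have [K K0 hK] := @cutoff_derive1n_bounded R m.
(* Order [m + 1] rather than [m]: the extra power of [|x|], which is at least [r] where the
   remainder lives, yields the factor [1 / r]. *)
have [M M0 hM] := rschwartz_uniform m.+1 hv.
pose D := C * (2 ^+ m * (1 + K) * M).
have K1 : 0 <= 1 + K by rewrite addr_ge0.
have D0 : 0 <= D by rewrite !mulr_ge0// exprn_ge0.
have bound r : 1 <= r -> Normc.normc (T (cplx v)) <= D / r.
  move=> r1; have r0 : 0 < r := lt_le_trans ltr01 r1.
  pose chi x : R := cutoff (x + r).
  have schi : rsmooth chi by apply: rsmooth_shift; exact: cutoff_smooth.
  have tchi : rtest (fun x => chi x * v x).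
    split; first exact: rsmoothM schi sv.
    exists (r + 1) => x; have [x0 _|x0] := leP 0 x.
      by rewrite ve ?mulr0// (lt_le_trans _ x0)// oppr_lt0.
    by rewrite ltr0_norm// => xr; rewrite /chi cutoff_le ?mul0r//; lra.
  pose c1 x : R := -1 * chi x + 1.
  have sNchi : rsmooth (fun x => -1 * chi x) by exact: rsmoothZ.
  have s1' := @rsmooth_cst R 1.
  have sc1 : rsmooth c1 by exact: (rsmoothD sNchi s1').
  have rtchi := rtest_rschwartz tchi.
  have -> : T (cplx v) = T (cplx (fun x => c1 x * v x)).
    have -> : (fun x => (c1 x * v x)%:C) = cplx (fun x => -1 * (chi x * v x) + v x).
      by apply/funext => x; rewrite /c1; congr (_%:C); ring.
    rewrite (tempered_lin _ rtchi hv).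
    by rewrite (tempered_test tchi e0) ?mulr0 ?add0r// => x /ve ->; rewrite mulr0.
  rewrite /D -[leRHS]mulrA; apply: hC.
    have -> : (fun x => c1 x * v x) = (fun x => -1 * (chi x * v x) + v x).
      by apply/funext => x; rewrite /c1; ring.
    exact: (rschwartz_lin _ rtchi hv).
  move=> l n x lm nm; have rhs0 : 0 <= 2 ^+ m * (1 + K) * M / r.
    by rewrite divr_ge0 ?(ltW r0)// !mulr_ge0// exprn_ge0.
  (* To the right of [- r - 1/2] the function [chi] is 1 and the remainder vanishes near [x]. *)
  have [xr|xr] := ltP (- r - 2^-1) x.
    rewrite (@derive1n_vanish _ _ `](- r - 2^-1), +oo[ n) ?normr0 ?mulr0//=.
    - move=> z; rewrite in_itv/= andbT => zr.
      by rewrite /c1 /chi cutoff_ge; [rewrite mulr1 addNr mul0r|lra].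
    - by rewrite in_itv/= andbT.
  have rx : r <= `|x| by rewrite ler0_norm; lra.
  have x0 : 0 < `|x| := lt_le_trans r0 rx.
  have hc1 i : (i <= n)%N -> `|derive1n i c1 x| <= 1 + K.
    move=> iN; rewrite /c1 (derive1nD i sNchi s1') (derive1nZ i (-1) schi) mulN1r addrC (le_trans (ler_normB _ _))// lerD//.
      by case: i {iN} => [|i]; rewrite ?derive1n_cst ?normr0 /= ?normr1.
    rewrite /chi derive1n_shift; last exact: cutoff_smooth.
    by apply: hK; exact: leq_trans nm.
  have hv' i : (i <= n)%N -> `|derive1n i v x| <= M / `|x| ^+ l.+1.
    move=> iN; rewrite ler_pdivlMr ?exprn_gt0// mulrC; apply: hM => //.
    by rewrite (leq_trans iN)// (leq_trans nm).
  have Mx0 : 0 <= M / `|x| ^+ l.+1 by rewrite divr_ge0// exprn_ge0.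
  have h := derive1nM_le sc1 sv K1 Mx0 hc1 hv'.
  apply: (@le_trans _ _ (`|x| ^+ l * (2 ^+ n * (1 + K) * (M / `|x| ^+ l.+1)))).
    by rewrite ler_wpM2l ?exprn_ge0.
  have -> : `|x| ^+ l * (2 ^+ n * (1 + K) * (M / `|x| ^+ l.+1)) =
      2 ^+ n * ((1 + K) * M / `|x|).
    by rewrite exprS; field; rewrite expf_neq0 gt_eqF.
  have -> : 2 ^+ m * (1 + K) * M / r = 2 ^+ m * ((1 + K) * M / r) by ring.
  apply: ler_pM => //.
  - by rewrite divr_ge0// mulr_ge0.
  - by rewrite ler_weXn2l// ler1n.
  - by rewrite ler_wpM2l ?mulr_ge0// lef_pV2 ?posrE.
apply: Normc.eq0_normc; apply/eqP; rewrite eq_le.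
set z := Normc.normc _; have z0 : 0 <= z.
  by rewrite /z; case: (T _) => a b /=; exact: sqrtr_ge0.
rewrite z0 andbT leNgt; apply/negP => zp.
have r1 : 1 <= D / z + 1 by rewrite lerDr divr_ge0.
have := bound _ r1; rewrite -/z ler_pdivlMr; last exact: lt_le_trans r1.
by rewrite mulrDr mulrCA divff ?gt_eqF// mulr1 mulr1; lra.
Qed.

End TemperedDistributions.

(** * The candidate for [p] and its Laplace transform *)

Section Uniqueness.
Context {R : realType}.
Local Notation mu := (@lebesgue_measure R).
Implicit Types (u v w : R -> R) (x t s c C : R).
Local Notation cplx u := (fun x => (u x)%:C).

Lemma cexp_real x : cexp (x%:C) = (expR x)%:C.
Proof. by rewrite /cexp /= cos0 sin0 mulr1 mulr0. Qed.

Lemma normr_Rintegral_real (D : set R) u : measurable D ->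
  mu.-integrable D (fun x => (u x)%:E) ->
  `|\int[mu]_(x in D) u x| <= \int[mu]_(x in D) `|u x|.
Proof. by move=> mD ui; apply: le_normr_Rintegral. Qed.

Variables (tau : R) (phi Psi : R -> R).
Hypotheses (tau0 : 0 < tau) (cPsi : continuous Psi).
Hypothesis PsiE : forall r, - tau <= r <= 0 -> Psi (r + tau) = phi r.

(* If Psi is constant on [tau, +oo[, this is the pairing with u of the
   derivative, in the sense of distributions, of the function equal to Psi on
   [0, +oo[ and to 0 on ]-oo, 0[. *)
Definition history_pairing u : R :=
  Psi tau * u tau - \int[mu]_(r in `[0, tau]) (Psi r * u^`()%classic r).

Let integrable_pairing w : continuous w ->
  mu.-integrable `[0, tau] (fun r => (Psi r * w r)%:E).
Proof.
move=> cw; apply: continuous_compact_integrable; first exact: segment_compact.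
by apply: continuous_subspaceT => x; apply: cvgM; [exact: cPsi|exact: cw].
Qed.

Lemma history_pairing_lin c u v : rsmooth u -> rsmooth v ->
  history_pairing (fun x => c * u x + v x) = c * history_pairing u + history_pairing v.
Proof.
move=> su sv; rewrite /history_pairing.
have iu := integrable_pairing (rsmooth_continuous (rsmooth_derive su)).
have iv := integrable_pairing (rsmooth_continuous (rsmooth_derive sv)).
have mI : measurable (`[0, tau]%classic : set R) by exact: measurable_itv.
have scu : rsmooth (fun x => c * u x) by exact: rsmoothZ.
have dE : (fun x => c * u x + v x)^`()%classic =
    fun x => c * u^`()%classic x + v^`()%classic x.
  rewrite -[LHS]/(derive1n 1 _) (derive1nD 1 scu sv).
  by rewrite (derive1nZ 1 c su).
rewrite dE (@eq_Rintegral _ _ _ mu _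
  (fun r => c * (Psi r * u^`()%classic r) + Psi r * v^`()%classic r)); last first.
  by move=> r _ /=; ring.
rewrite (Rintegral_realD mI (integrable_realZ c mI iu) iv) (Rintegral_realZ c mI iu).
move: (Rintegral _ _ _) => I; move: (Rintegral _ _ _) => J; ring.
Qed.

Lemma history_pairing_bound : exists2 B, 0 <= B & forall u C, rsmooth u -> 0 <= C ->
  (forall t, 0 <= t <= tau -> `|u t| <= C) ->
  (forall t, 0 <= t <= tau -> `|u^`()%classic t| <= C) ->
  `|history_pairing u| <= B * C.
Proof.
have [M M0 hM] := @segment_bounded R Psi 0 tau cPsi.
exists (M + M * tau) => [|u C su C0 hu hu']; first by rewrite addr_ge0// mulr_ge0// ltW.
have iu := integrable_pairing (rsmooth_continuous (rsmooth_derive su)).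
have mI : measurable (`[0, tau]%classic : set R) by exact: measurable_itv.
rewrite /history_pairing (le_trans (ler_normB _ _))// mulrDl lerD//.
  by rewrite normrM ler_pM// ?hM ?hu ?(ltW tau0) ?lexx.
apply: (le_trans (normr_Rintegral_real mI iu)).
have -> : M * tau * C = \int[mu]_(r in `[0, tau]) (M * C).
  rewrite Rintegral_cst//= lebesgue_measure_itv/= lte_fin tau0/= subr0; ring.
apply: le_Rintegral => //.
- exact: (integrable_norm iu).
- apply: continuous_compact_integrable; first exact: segment_compact.
  by apply: continuous_subspaceT => x; exact: cvg_cst.
- move=> r; rewrite /= in_itv/= => r0; rewrite normrM ler_pM//; first exact: hM.
  exact: hu'.
Qed.

(** Both sides equal [Psi tau e^(-s tau)] plus [s] times the integral of [Psi r e^(-s r)] over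
    [[0, tau]]: on the left by translating the integral over [[-tau, 0]], on the right by
    differentiating the exponential. Real [s] covers the points [s1 + n] used for uniqueness. *)
Lemma laplace_history_pairing s :
  cexp (- s%:C * tau%:C) * P_tau tau phi s%:C =
  (history_pairing (fun t => expR (- s * t)))%:C.
Proof.
have mI : measurable (`[0, tau]%classic : set R) by exact: measurable_itv.
have cE c : continuous (fun t => expR (c * t) : R).
  by apply: rsmooth_continuous; exact: rsmooth_exp.
have intE : cintegral `[- tau, 0] (fun r => cexp (- s%:C * r%:C) * (phi r)%:C) =
    (expR (s * tau) * \int[mu]_(r in `[0, tau]) (Psi r * expR (- s * r)))%:C.
  rewrite -(Rintegral_realZ _ mI (integrable_pairing (cE _))).
  pose g r := expR (s * tau) * (Psi r * expR (- s * r)).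
  have mg : measurable_fun setT (g \_ `[0, tau]).
    apply/(measurable_restrictT g) => //; apply: measurable_funTS.
    apply: continuous_measurable_fun => x; apply: cvgM; first exact: cvg_cst.
    by apply: cvgM; [exact: cPsi|exact: cE].
  have -> : (fun r => cexp (- s%:C * r%:C) * (phi r)%:C) =
      cplx (fun r => expR (- s * r) * phi r).
    by apply/funext => r; rewrite -rmorphN -rmorphM cexp_real -rmorphM.
  apply: complexP => /=; last by rewrite Rintegral_cst// mul0r.
  rewrite [LHS]Rintegral_mkcond [RHS]Rintegral_mkcond -[RHS](Rintegral_shift tau mg).
  apply: eq_Rintegral => r _; rewrite !patchE.
  have -> : (r + tau \in `[0, tau]%classic) = (r \in `[- tau, 0]%classic).
    by apply/idP/idP; rewrite !inE/= !in_itv/= => /andP[? ?]; apply/andP; split; lra.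
  case: ifPn => //; rewrite inE/= in_itv/= => hr.
  rewrite /g PsiE// (mulrC (phi r)) mulrA -expRD; congr (expR _ * _); ring.
rewrite /P_tau intE -rmorphN -!rmorphM cexp_real -rmorphD -rmorphM; congr (_%:C).
have -> : phi 0 = Psi tau by rewrite -PsiE ?add0r// lexx oppr_le0 ltW.
rewrite /history_pairing.
have dE : (fun t => expR (- s * t))^`()%classic = fun t => - s * expR (- s * t).
  exact: derive1_eq (is_derive_exp (- s)).
rewrite dE [in RHS](@eq_Rintegral _ _ _ mu _ (fun r => - s * (Psi r * expR (- s * r)))); last first.
  by move=> r _; rewrite mulrCA.
rewrite (Rintegral_realZ (- s) mI (integrable_pairing (cE _))).
have eE : expR (- s * tau) * expR (s * tau) = 1 :> R.
  by rewrite -expRD mulNr addNr expR0.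
move: (Rintegral _ _ _) => I; move: (expR (- s * tau)) (expR (s * tau)) eE => e E eE.
have -> : e * (Psi tau + s * (E * I)) = Psi tau * e + s * (e * E) * I by ring.
by rewrite eE; ring.
Qed.

End Uniqueness.

(** * Injectivity of the Laplace transform *)

Section InverseLaplace.
Context {R : realType}.
Local Notation mu := (@lebesgue_measure R).
Implicit Types (u v w d : R -> R) (x t c : R) (a : nat -> R).
Local Notation cplx u := (fun x => (u x)%:C).

Lemma derive1n_exp n c : derive1n n (fun t => expR (c * t)) = fun t => c ^+ n * expR (c * t).
Proof.
elim: n => [|n ih]; first by apply/funext => t; rewrite mul1r.
rewrite derive1Sn (_ : _^`()%classic = fun t => c * expR (c * t)).
  rewrite derive1nZ; last exact: rsmooth_exp.
  by rewrite ih; apply/funext => t; rewrite exprS mulrA.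
exact: derive1_eq (is_derive_exp c).
Qed.

Lemma cutoff_exp_rschwartz i :
  rschwartz (fun x => cutoff x * expR (- i.+1%:R * x)).
Proof.
apply: cutoff_mul_rschwartz; first exact: rsmooth_exp.
move=> j; exists (i.+1%:R ^+ j * expR i%:R) => t t1; rewrite derive1n_exp.
rewrite normrM normrX normrN !ger0_norm ?expR_ge0// -mulrA.
rewrite ler_wpM2l ?exprn_ge0// -expRD ler_expR.
have -> : i.+1%:R = i%:R + 1 :> R by rewrite natr1.
have : 0 <= i%:R * (t + 1) by rewrite mulr_ge0//; lra.
lra.
Qed.

Lemma expsum_recr N a x : expsum N.+1 a x = a N * expR (- N.+1%:R * x) + expsum N a x.
Proof. by rewrite /expsum big_ord_recr/= addrC. Qed.

Lemma cutoff_expsum_recr N a : (fun x => cutoff x * expsum N.+1 a x) =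
  fun x => a N * (cutoff x * expR (- N.+1%:R * x)) + cutoff x * expsum N a x.
Proof. by apply/funext => x; rewrite expsum_recr; ring. Qed.

Lemma rtest0 : rtest (fun=> 0 : R).
Proof. by split; [exact: rsmooth_cst|exists 0]. Qed.

Lemma cutoff_expsum0 a : (fun x => cutoff x * expsum 0 a x) = fun=> 0 : R.
Proof. by apply/funext => x; rewrite /expsum big_ord0 mulr0. Qed.

Lemma cutoff_expsum_rschwartz N a : rschwartz (fun x => cutoff x * expsum N a x).
Proof.
elim: N => [|N ih]; first by rewrite cutoff_expsum0; exact: rtest_rschwartz rtest0.
by rewrite cutoff_expsum_recr; exact: (rschwartz_lin _ (cutoff_exp_rschwartz N) ih).
Qed.

Lemma eq0_small_bound x D : (forall e, 0 < e -> `|x| <= D * e) -> x = 0.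
Proof.
move=> h; apply/eqP; rewrite -normr_le0 leNgt; apply/negP => x0.
have D0 : 0 < D.
  by have := lt_le_trans x0 (h 1 ltr01); rewrite mulr1.
have e0 : 0 < `|x| / (2 * D) by rewrite divr_gt0// mulr_gt0.
have := h _ e0; have -> : D * (`|x| / (2 * D)) = `|x| / 2.
  by field; rewrite gt_eqF.
lra.
Qed.

Lemma complex_close (P z : R[i]) (h q a b : R) : P - h%:C = z - q%:C ->
  Normc.normc z <= a -> `|q| <= b ->
  `|complex.Re P - h| <= a + b /\ `|complex.Im P| <= a + b.
Proof.
move=> zq hz hq; have b0 : 0 <= b := le_trans (normr_ge0 q) hq.
have reB (x y : R[i]) : complex.Re (x - y) = complex.Re x - complex.Re y.
  by case: x y => [? ?] [? ?].
have imB (x y : R[i]) : complex.Im (x - y) = complex.Im x - complex.Im y.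
  by case: x y => [? ?] [? ?].
split.
  have := congr1 (@complex.Re R) zq; rewrite !reB /= => ->.
  rewrite (le_trans (ler_normB _ _))// lerD//.
  exact: le_trans (Re_le_normc z) hz.
have := congr1 (@complex.Im R) zq; rewrite !imB /= !subr0 => ->.
rewrite (le_trans (Im_le_normc z))// (le_trans hz)//.
by rewrite lerDl.
Qed.

Lemma exp_mul_le c b e t d : rsmooth d -> 0 < e -> 0 <= t <= b ->
  `|d t| <= e * expR (- t) -> `|d^`()%classic t| <= e * expR (- t) ->
  `|expR (- c * t) * d t| <= (`|c| + 1) * expR (`|c| * b) * e /\
  `|(fun t => expR (- c * t) * d t)^`()%classic t| <= (`|c| + 1) * expR (`|c| * b) * e.
Proof.
move=> sd e0 /andP[t0 tb] hd hd'.
have e1 : e * expR (- t) <= e by rewrite ger_pMr// expR_le1 oppr_le0.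
have wE : expR (- c * t) <= expR (`|c| * b).
  rewrite ler_expR (le_trans (ler_norm _))// normrM normrN (ger0_norm t0).
  by rewrite ler_wpM2l.
have dE : `|d t| <= e by exact: le_trans hd e1.
have dE' : `|d^`()%classic t| <= e by exact: le_trans hd' e1.
rewrite (mulrC (_ + 1)) -mulrA; split.
  rewrite normrM (ger0_norm (expR_ge0 _)) ler_pM ?expR_ge0// (le_trans dE)//.
  by rewrite ler_peMl ?(ltW e0)// lerDr.
have -> : (fun t => expR (- c * t) * d t)^`()%classic t =
    expR (- c * t) * (- c * d t + d^`()%classic t).
  rewrite (derive1M (@rsmooth_exp R (- c)) sd).
  by rewrite -[_^`()%classic t]/(derive1n 1 _ t) (derive1n_exp 1) expr1; ring.
rewrite normrM (ger0_norm (expR_ge0 _)) ler_pM ?expR_ge0//.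
rewrite (le_trans (ler_normD _ _))// mulrDl mul1r lerD//.
by rewrite normrM normrN ler_wpM2l.
Qed.

Variables (tau : R) (phi Psi : R -> R) (p : (R -> R[i]) -> R[i]).
Hypotheses (tau0 : 0 < tau) (cPsi : continuous Psi).
Hypothesis PsiE : forall r, - tau <= r <= 0 -> Psi (r + tau) = phi r.
Hypothesis laplace_p : inverse_laplace_transform
  (fun s : R[i] => cexp (- s * tau%:C) * P_tau tau phi s) p.

Let hp := history_pairing tau Psi.

(** [T] on cut-off exponential sums agrees with the weighted pairing [Q] on the sums themselves.
    Both are bounded by finitely many derivatives with weight [e^(-t)], so approximating
    [e^(s1 t) u] by a sum makes [p u - hp u] arbitrarily small. *)
Theorem inverse_laplace_unique u : rtest u -> p (cplx u) = (hp u)%:C.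
Proof.
move=> tu; have [su [K uK]] := tu; have [_ supp_p [s0 lap]] := laplace_p.
pose s1 := s0 + 1; have s01 : s0 < s1 by rewrite ltrDl.
have [T [tT Tp Tl]] := lap s1 s01.
pose Q w := hp (fun t => expR (- s1 * t) * w t).
have se c : rsmooth (fun t : R => expR (c * t)) by exact: rsmooth_exp.
have sQ w : rsmooth w -> rsmooth (fun t => expR (- s1 * t) * w t).
  by move=> sw; exact: (rsmoothM (se (- s1)) sw).
have Qlin c w w' : rsmooth w -> rsmooth w' -> Q (fun t => c * w t + w' t) = c * Q w + Q w'.
  move=> sw sw'; rewrite /Q /hp -(history_pairing_lin tau cPsi _ (sQ _ sw) (sQ _ sw')).
  by congr history_pairing; apply/funext => t; ring.
(* The transform is the value of [T] at some [theta] equal to the exponential near [[0, +oo[]. By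
   [tempered_vanish], its imaginary part contributes 0 and its real part may be replaced by the
   cut-off exponential. *)
have Texp i : T (cplx (fun x => cutoff x * expR (- i.+1%:R * x))) =
    (Q (fun t => expR (- i.+1%:R * t)))%:C.
  have s1i : s1 < complex.Re ((s1 + i.+1%:R)%:C) by rewrite /= ltrDl.
  have [theta [stheta [e e0 thetaE] Ttheta]] := Tl _ s1i.
  have hE x : - e < x -> theta x = (expR (- i.+1%:R * x))%:C.
    move=> /thetaE ->; rewrite -rmorphB -rmorphN -rmorphM cexp_real.
    by have -> : s1 + i.+1%:R - s1 = i.+1%:R by rewrite addrAC subrr add0r.
  have [sre sim] := schwartz_parts stheta.
  have Tim : T (cplx (fun x => complex.Im (theta x))) = 0.
    by apply: (tempered_vanish supp_p tT Tp sim e0) => x /hE ->.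
  have Tre : T (cplx (fun x => complex.Re (theta x))) =
      T (cplx (fun x => cutoff x * expR (- i.+1%:R * x))).
    have sc := cutoff_exp_rschwartz i.
    have e'0 : 0 < Num.min e 2^-1 by rewrite lt_min e0/= invr_gt0 ltr0n.
    have := tempered_vanish supp_p tT Tp (rschwartz_lin (-1) sc sre) e'0.
    rewrite (tempered_lin tT _ sc sre) rmorphN1 mulN1r => h; apply/eqP.
    rewrite -subr_eq0 addrC h// => x; rewrite ltrNl lt_min => /andP[xe x2].
    have xe' : - e < x by rewrite ltrNl.
    have x2' : - 2^-1 <= x by rewrite lerNl ltW.
    by rewrite (hE _ xe') (cutoff_ge x2') mul1r mulN1r addNr.
  rewrite -Tre; have [lin _] := tT.
  have := lin 'i _ _ (rschwartz_schwartz sim) (rschwartz_schwartz sre).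
  rewrite Tim mulr0 add0r => <-.
  rewrite (_ : (fun x => _) = theta); last first.
    by apply/funext => x; exact: complex_recompose.
  rewrite Ttheta (laplace_history_pairing tau0 cPsi PsiE) /Q /hp.
  by congr ((history_pairing _ _ _)%:C); apply/funext => t; rewrite -expRD;
    congr expR; ring.
have Tsum N a : T (cplx (fun x => cutoff x * expsum N a x)) = (Q (expsum N a))%:C.
  elim: N => [|N ih].
    rewrite (_ : (fun x => _) = cplx (fun=> 0)); last first.
      by apply/funext => x; rewrite /expsum big_ord0 mulr0.
    rewrite (tempered_test supp_p Tp rtest0 ltr01)//.
    have s00 : rsmooth (fun=> 0 : R) by exact: rsmooth_cst.
    have -> : expsum 0 a = fun=> 0 : R.
      by apply/funext => x; rewrite /expsum big_ord0.
    have := Qlin 1 _ _ s00 s00.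
    have -> : (fun t : R => 1 * 0 + 0) = fun=> 0 : R.
      by apply/funext => x; rewrite mul1r addr0.
    move=> /eqP; rewrite mul1r -subr_eq0 opprD addrA subrr sub0r oppr_eq0.
    by move=> /eqP ->.
  rewrite (_ : (fun x => _) = cplx (fun x => a N * (cutoff x *
      expR (- N.+1%:R * x)) + cutoff x * expsum N a x)); last first.
    by apply/funext => x; have /(congr1 (@^~ x)) /= -> := cutoff_expsum_recr N a.
  rewrite (tempered_lin tT _ (cutoff_exp_rschwartz N) (cutoff_expsum_rschwartz N a)).
  rewrite Texp ih -rmorphM -rmorphD -Qlin; [|exact: (se _)|exact: rsmooth_expsum].
  by congr ((Q _)%:C); apply/funext => x; rewrite expsum_recr.
(* This weight cancels the [e^(-s1 t)] built into [T] and [Q]. *)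
pose v t := expR (s1 * t) * u t.
have tv : rtest v by exact: (rtestM (se s1) tu).
have sv := tv.1.
have pT : p (cplx u) = T (cplx v).
  rewrite Tp; last exact: rtest_test.
  congr p; apply/funext => t; rewrite /v -rmorphM mulrA -expRD addNr expR0 mul1r //.
have Qv : Q v = hp u.
  congr history_pairing; apply/funext => t.
  by rewrite /v mulrA -expRD mulNr addNr expR0 mul1r.
have tcv : rtest (fun x => cutoff x * v x) by exact: (rtestM (@cutoff_smooth R) tv).
have scv := rtest_rschwartz tcv.
have Tcv : T (cplx (fun x => cutoff x * v x)) = T (cplx v).
  have sv' := rtest_rschwartz tv.
  have h0 : 0 < 2^-1 :> R by rewrite invr_gt0.
  have := tempered_vanish supp_p tT Tp (rschwartz_lin (-1) scv sv') h0.
  rewrite (tempered_lin tT _ scv sv') rmorphN1 mulN1r => h; apply/esym/eqP.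
  rewrite -subr_eq0 addrC; apply/eqP; apply: h => x x2.
  by rewrite (cutoff_ge (ltW x2)) mul1r mulN1r addNr.
have vK t : K < t -> v t = 0.
  by move=> Kt; rewrite /v (uK _ (lt_le_trans Kt (ler_norm t))) mulr0.
have [m [C C0 hC]] := tempered_bound tT.
have [B B0 hB] := @cutoff_mul_bound R m.
have [B' B'0 hB'] := history_pairing_bound tau0 cPsi.
pose E := expR (`|s1| * tau); have E0 : 0 <= E by exact: expR_ge0.
pose D := C * B + B' * ((`|s1| + 1) * E).
have main e : 0 < e -> exists z : R[i], exists q : R,
    [/\ p (cplx u) - (hp u)%:C = z - q%:C, Normc.normc z <= C * B * e &
        `|q| <= B' * ((`|s1| + 1) * E) * e].
  (* [T] is controlled by [m] derivatives, [Q] by the first one. *)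
  move=> e0; have [N [a ha]] := expsum_approx (maxn m 1) sv vK e0.
  have ss : rsmooth (expsum N a) by exact: rsmooth_expsum.
  pose d x := v x + expsum N a x.
  have sd : rsmooth d by exact: (rsmoothD sv ss).
  exists (T (cplx (fun x => cutoff x * d x))), (Q d).
  have cdE : (fun x => cutoff x * d x) =
      fun x => 1 * (cutoff x * v x) + cutoff x * expsum N a x.
    by apply/funext => x; rewrite /d; ring.
  have scs := cutoff_expsum_rschwartz N a.
  split.
  - rewrite (_ : (fun x => (cutoff x * d x)%:C) = cplx (fun x =>
        1 * (cutoff x * v x) + cutoff x * expsum N a x)); last first.
      by apply/funext => x; have /(congr1 (@^~ x)) /= -> := cdE.
    rewrite (tempered_lin tT _ scv scs) Tcv Tsum mul1r pT.
    have -> : Q d = Q v + Q (expsum N a).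
      rewrite -[Q v]mul1r -(Qlin 1 _ _ sv ss); congr Q; apply/funext => x.
      by rewrite mul1r.
    rewrite Qv; move: (T _) (hp u) (Q _) => z x y.
    by rewrite rmorphD opprD addrACA subrr addr0.
  - rewrite -mulrA; apply: hC; first by rewrite cdE; exact: (rschwartz_lin _ scv scs).
    apply: (hB d e sd (ltW e0)) => j t jm t1.
    exact: (ha j t (leq_trans jm (leq_maxl m 1)) t1).
  - rewrite -[leRHS]mulrA.
    apply: (hB' (fun t => expR (- s1 * t) * d t) ((`|s1| + 1) * E * e) (sQ d sd)).
    - by rewrite (mulr_ge0 (mulr_ge0 _ E0) (ltW e0))// addr_ge0.
    - move=> t tt; have t1 : -1 <= t.
        by case/andP: tt => t0 _; apply: le_trans t0; rewrite oppr_le0.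
      exact: (exp_mul_le s1 sd e0 tt (ha 0%N t (leq0n _) t1) (ha 1%N t (leq_maxr _ _) t1)).1.
    - move=> t tt; have t1 : -1 <= t.
        by case/andP: tt => t0 _; apply: le_trans t0; rewrite oppr_le0.
      exact: (exp_mul_le s1 sd e0 tt (ha 0%N t (leq0n _) t1) (ha 1%N t (leq_maxr _ _) t1)).2.
have zero : complex.Re (p (cplx u)) - hp u = 0 /\ complex.Im (p (cplx u)) = 0.
  split; apply: (@eq0_small_bound _ D) => e e0; have [z [q [zq hz hq]]] := main e e0;
    rewrite /D mulrDl; have [re im] := complex_close zq hz hq; [exact: re|exact: im].
have [re0 im0] := zero; apply: complexP; last exact: im0.
by apply/eqP; rewrite -subr_eq0; apply/eqP; exact: re0.
Qed.

End InverseLaplace.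

(** * Correlations: smoothness and support *)

Section Correlation.
Context {R : realType}.
Local Notation mu := (@lebesgue_measure R).
Implicit Types (u v w g : R -> R) (x t r L K : R).

Lemma Rintegral_support u L : (forall x, L < `|x| -> u x = 0) ->
  \int[mu]_x u x = \int[mu]_(x in `[- L, L]) u x.
Proof.
move=> uL; rewrite [RHS]Rintegral_mkcond; apply: eq_Rintegral => x _.
rewrite patchE; case: ifPn => //; rewrite notin_setE/= in_itv/= -ler_norml.
by move=> /negP; rewrite -ltNge => /uL.
Qed.

Lemma integrable_support u L : continuous u -> (forall x, L < `|x| -> u x = 0) ->
  mu.-integrable setT (EFin \o u).
Proof.
move=> cu uL; have i : mu.-integrable `[- L, L] (EFin \o u).
  apply: continuous_compact_integrable; first exact: segment_compact.
  exact: continuous_subspaceT.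
apply/integrableP; split.
  by apply/measurable_EFinP; exact: continuous_measurable_fun.
case/integrableP : i => _; rewrite integral_mkcond.
congr (_ < _)%E; apply: eq_integral => x _; rewrite patchE; case: ifPn => //.
rewrite notin_setE/= in_itv/= -ler_norml => /negP; rewrite -ltNge => /uL ->.
by rewrite normr0.
Qed.

Lemma rtest_derive u : rtest u -> rtest u^`()%classic.
Proof.
move=> [su [K uK]]; split; first exact: rsmooth_derive.
by exists K => x; exact: (derive1n_vanish 1 (@open_norm_gt _ K) uK).
Qed.

(** The adjoint of convolution with [g], that is, the inner integral of [continuous_convolution]. *)
Definition correlation g u r : R := \int[mu]_x (g x * u (r + x)).

Lemma continuous_translate u r : continuous u -> continuous (fun x => u (r + x)).
Proof.
move=> cu x; apply: (@continuous_comp _ _ _ (fun x => r + x) u); last exact: cu.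
by apply: cvgD; [exact: cvg_cst|exact: cvg_id].
Qed.

Lemma correlation_integrable g u r : continuous g -> rtest u ->
  mu.-integrable setT (EFin \o (fun x => g x * u (r + x))).
Proof.
move=> cg [su [K uK]]; apply: (@integrable_support _ (`|r| + K)).
  move=> x; apply: cvgM; first exact: cg.
  exact: (@continuous_translate u r (rsmooth_continuous su) x).
move=> x hx; rewrite uK ?mulr0//.
have := ler_normB (r + x) r; rewrite addrAC subrr add0r; lra.
Qed.

Lemma is_derive_correlation g u r : continuous g -> rtest u ->
  is_derive r 1 (correlation g u) (correlation g u^`()%classic r).
Proof.
move=> cg tu; have [su [K uK]] := tu.
have [M M0 hM] := rtest_derive1n_bounded 1 tu.
have tu' := rtest_derive tu; have [_ [K' uK']] := tu'.
(* For [|x - r| <= 1], the condition [|x + y| <= K'] forces [|y| <= L], so one compactly supported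
   majorant serves all nearby [x]. *)
pose L := `|r| + 1 + K'.
pose G x : R := ((fun x => M * `|g x|) \_ `[- L, L]) x.
have G0 x : 0 <= G x.
  by rewrite /G patchE; case: ifP => // _; rewrite mulr_ge0.
have iG : mu.-integrable setT (EFin \o G).
  have i : mu.-integrable `[- L, L] (EFin \o (fun x => M * `|g x|)).
    apply: continuous_compact_integrable; first exact: segment_compact.
    apply: continuous_subspaceT => x; apply: cvgM; first exact: cvg_cst.
    by apply: (@continuous_comp _ _ _ g); [exact: cg|exact: norm_continuous].
  apply/integrableP; split.
    apply/measurable_EFinP.
    apply/(measurable_restrictT (fun x => M * `|g x|)) => //; apply: measurable_funTS.
    apply: measurable_funM => //; apply: measurableT_comp => //.
    exact: continuous_measurable_fun.
  case/integrableP : i => _; rewrite integral_mkcond.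
  congr (_ < _)%E; apply: eq_integral => x _; rewrite /G /= !patchE.
  by case: ifP => // _; rewrite normr0.
pose f x y : R := g y * u (x + y).
have df x y : is_derive x 1 (f ^~ y) (g y * u^`()%classic (x + y)).
  have du := rsmooth_is_derive (x + y) su.
  have dx : is_derive x 1 (fun x => x + y) 1 by apply: is_derive_eq; rewrite addr0.
  have dux : is_derive x 1 (fun x => u (x + y)) (u^`()%classic (x + y)).
    rewrite -[X in is_derive _ _ _ X]mulr1.
    exact: (@is_derive1_comp R u (fun x => x + y) x _ _ du dx).
  exact: (@is_deriveZ _ _ _ (fun x => u (x + y)) (g y) x 1 _ dux).
have pf x y : partial1of2 f x y = g y * u^`()%classic (x + y).
  by rewrite partial1of2E; have [_ ->] := df x y.
have rI : `](r - 1), (r + 1)[%classic r by rewrite /= in_itv/=; apply/andP; split; lra.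
have intf x : `](r - 1), (r + 1)[%classic x -> mu.-integrable setT (EFin \o f x).
  by move=> _; exact: correlation_integrable.
have derf x y : `](r - 1), (r + 1)[%classic x -> setT y -> derivable (f ^~ y) x 1.
  by move=> _ _; have [] := df x y.
have Gub x y : `](r - 1), (r + 1)[%classic x -> setT y -> `|partial1of2 f x y| <= G y.
  rewrite /= in_itv/= => /andP[x1 x2] _; rewrite pf normrM /G patchE; case: ifPn.
    by move=> _; rewrite mulrC ler_wpM2r//; exact: hM.
  rewrite notin_setE/= in_itv/= -ler_norml => /negP; rewrite -ltNge => Ly.
  rewrite uK' ?normr0 ?mulr0//.
  have := ler_normB (x + y) x; rewrite addrAC subrr add0r => h.
  have : `|x| <= `|r| + 1.
    have xr : `|x - r| <= 1 by rewrite ler_norml; apply/andP; split; lra.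
    have -> : x = r + (x - r) by ring.
    by rewrite (le_trans (ler_normD _ _))// lerD2l.
  move: Ly; rewrite /L; lra.
have d1 := @derivable_under_integral _ _ _ mu f setT measurableT r (r - 1) (r + 1)
  rI intf derf G G0 iG Gub.
have d2 := @differentiation_under_integral _ _ _ mu f setT measurableT r (r - 1) (r + 1)
  rI intf derf G G0 iG Gub.
apply: DeriveDef; first exact: d1.
rewrite -derive1E; apply: etrans d2 _; apply: eq_Rintegral => y _; exact: pf.
Qed.

Lemma correlation_smooth g u : continuous g -> rtest u -> rsmooth (correlation g u).
Proof.
move=> cg tu; apply/rsmoothP => n; elim: n u tu => // n ih u tu.
apply: (Cn_is_derive (fun r => is_derive_correlation r cg tu)).
by apply: ih; exact: rtest_derive.
Qed.

Lemma correlation_derive1 g u : continuous g -> rtest u ->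
  (correlation g u)^`()%classic = correlation g u^`()%classic.
Proof. by move=> cg tu; apply: derive1_eq => r; exact: is_derive_correlation. Qed.

Lemma correlation_vanish g u K : (forall x, x < 0 -> g x = 0) ->
  (forall x, K < `|x| -> u x = 0) -> forall r, K < r -> correlation g u r = 0.
Proof.
move=> g0 uK r Kr; rewrite /correlation /Rintegral integral0_eq// => x _.
have [x0|x0] := ltP x 0; first by rewrite g0// mul0r.
by rewrite uK ?mulr0// (lt_le_trans Kr)// (le_trans _ (ler_norm _))// lerDl.
Qed.

End Correlation.

(** * Convolution of the candidate distribution with a delayed power *)

Section PairingConvolution.
Context {R : realType}.
Local Notation mu := (@lebesgue_measure R).
Implicit Types (u : R -> R) (x t r : R).

(** The conventions at [t = k tau] agree because the exponent [(k + 1) alpha] is positive. *)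
Lemma delayed_powerE (alpha tau : R) k t : 0 < alpha ->
  delayed_power alpha tau k t = frac_kernel (k.+1%:R * alpha + 1) (t - k%:R * tau).
Proof.
move=> a0; have b0 : 0 < k.+1%:R * alpha by rewrite mulr_gt0.
rewrite /delayed_power /frac_kernel /tpow addrK subr_gt0 le_eqVlt.
case: eqVneq => [->|_] /=; last by case: ifP => // _; rewrite mul0r.
by rewrite ltxx subrr powR0 ?gt_eqF// mul0r.
Qed.

Lemma is_derive_eq_integral (F f : R -> R) a b : a < b -> continuous f ->
  (forall x, is_derive x 1 F (f x)) -> \int[mu]_(x in `[a, b]) f x = F b - F a.
Proof.
move=> ab cf dF; have cF := is_derive_continuous dF.
rewrite /Rintegral (@continuous_FTC2 _ f F a b ab)//.
- exact: continuous_subspaceT.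
- split=> [x _| |]; first by have [] := dF x.
    by apply: cvg_at_right_filter; exact: cF.
  by apply: cvg_at_left_filter; exact: cF.
- by move=> x _; rewrite derive1E; have [_ ->] := dF x.
Qed.

Variables (tau b s : R) (Psi : R -> R).
Hypotheses (tau0 : 0 < tau) (b0 : 0 < b) (s0 : 0 <= s) (cPsi : continuous Psi).
Hypothesis Psi_cst : forall r, tau <= r -> Psi r = Psi tau.

(** [C] is the convolution of [g] with [pos Psi], and its derivative [c] is the expected convolution
    of [g] with the derivative of [pos Psi]. The derivative thus falls on [C], never on [Psi]. *)
Let g t := frac_kernel (b + 1) (t - s).
Let C t := RLint (b + 1) (pos Psi) (t - s).
Let c t := RLint b (pos Psi) (t - s).

Let b10 : 0 < b + 1. Proof. by rewrite addr_gt0. Qed.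

Let cg : continuous g.
Proof.
apply: (@continuous_shift R _ (frac_kernel (b + 1))) => t.
by apply: cvgM; [exact: tpow_continuous|exact: cvg_cst].
Qed.

Let g_lt0 t : t < 0 -> g t = 0.
Proof.
by move=> t0; apply: frac_kernel_le0; rewrite subr_le0 (le_trans (ltW t0)).
Qed.

Let is_derive_C t : is_derive t 1 C (c t).
Proof.
have dR := is_derive_RLint (t - s) b0 (causal_pos cPsi) (RLint_pos_continuous b0 cPsi).
have ds : is_derive t 1 (fun t => t - s) 1 by apply: is_derive_eq; rewrite subr0.
rewrite -[c t]mulr1.
exact: (@is_derive1_comp R (RLint (b + 1) (pos Psi)) (fun t => t - s) t _ _ dR ds).
Qed.

Let cc : continuous c.
Proof.
by apply: (@continuous_shift R _ (RLint b (pos Psi))); exact: RLint_pos_continuous.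
Qed.

(** [Psi] is constant past [tau], so the boundary term at [tau] is minus the integral over the tail,
    where the correlation ends at 0. The jump of [pos Psi] at 0, hence the Dirac mass, is thereby
    included. *)
Let history_pairing_half_line u : rtest u ->
  history_pairing tau Psi (correlation g u) =
  - \int[mu]_r (pos Psi r * correlation g u^`()%classic r).
Proof.
move=> tu; have [su [K uK]] := tu; have tu' := rtest_derive tu.
have [su' [K' uK']] := tu'.
pose L := Num.max tau (Num.max K K') + 1.
have [tL KL KL'] : [/\ tau < L, K < L & K' < L].
  by split; rewrite /L ltr_pwDr// !le_max lexx ?orbT.
rewrite /history_pairing (correlation_derive1 cg tu).
set G' := correlation g u^`()%classic.
have sG' : rsmooth G' by exact: correlation_smooth.
have cG' := rsmooth_continuous sG'.
have cPG : continuous (fun r => Psi r * G' r).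
  by move=> r; apply: cvgM; [exact: cPsi|exact: cG'].
have int_itv (h : R -> R) x y : continuous h -> mu.-integrable `[x, y] (EFin \o h).
  move=> ch; apply: continuous_compact_integrable; first exact: segment_compact.
  exact: continuous_subspaceT.
have tail : \int[mu]_(r in `]tau, L]) (Psi r * G' r) = - (Psi tau * correlation g u tau).
  have -> : \int[mu]_(r in `]tau, L]) (Psi r * G' r) =
      \int[mu]_(r in `]tau, L]) (Psi tau * G' r).
    apply: eq_Rintegral => r; rewrite inE/= in_itv/= => /andP[tr _].
    by rewrite (Psi_cst (ltW tr)).
  have cPt : continuous (fun r => Psi tau * G' r).
    by move=> r; apply: cvgM; [exact: cvg_cst|exact: cG'].
  have ioc : mu.-integrable `]tau, L] (EFin \o (fun r => Psi tau * G' r)).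
    apply: integrableS (int_itv _ tau L cPt) => //.
    by apply: subset_itvr; rewrite bnd_simp.
  rewrite (Rintegral_itv_obnd_cbnd ioc).
  have mI : measurable (`[tau, L]%classic : set R) by exact: measurable_itv.
  rewrite (Rintegral_realZ _ mI (int_itv _ tau L cG')).
  have dG x := is_derive_correlation x cg tu.
  rewrite (is_derive_eq_integral tL cG' dG).
  by rewrite (correlation_vanish g_lt0 uK KL) sub0r mulrN.
have itvB := @Rintegral_itvB R (fun r => Psi r * G' r) (BLeft 0) (BRight L) tau
  (int_itv _ 0 L cPG).
rewrite !bnd_simp (ltW tL) (ltW tau0) in itvB; have {}itvB := itvB isT isT.
rewrite tail in itvB.
have -> : Psi tau * correlation g u tau - \int[mu]_(r in `[0, tau]) (Psi r * G' r) =
   - \int[mu]_(r in `[0, L]) (Psi r * G' r).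
  move: itvB; move: (Rintegral _ _ _) (Rintegral _ _ _) (_ * _) => X Y Z e.
  lra.
congr (- _).
have ioc : mu.-integrable `]0, L] (EFin \o (fun r => Psi r * G' r)).
  apply: integrableS (int_itv _ 0 L cPG) => //.
  by apply: subset_itvr; rewrite bnd_simp.
rewrite -(Rintegral_itv_obnd_cbnd ioc) Rintegral_mkcond; apply: eq_Rintegral => r _.
rewrite patchE; case: ifPn.
  by rewrite inE/= in_itv/= => /andP[r0 _]; rewrite /pos r0.
rewrite notin_setE/= in_itv/= => /negP; rewrite negb_and -ltNge -leNgt.
move=> /orP[r0|Lr]; first by rewrite /pos ltNge r0 mul0r.
by rewrite /G' (correlation_vanish g_lt0 uK') ?mulr0// (lt_trans KL').
Qed.

Let fubini_pairing u : rtest u ->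
  \int[mu]_r (pos Psi r * correlation g u^`()%classic r) =
  \int[mu]_t (C t * u^`()%classic t).
Proof.
move=> tu; have [sv [K vK]] := rtest_derive tu.
move: (u^`()%classic) sv vK => v sv vK; have cv := rsmooth_continuous sv.
have mv : measurable_fun setT v by exact: continuous_measurable_fun.
have mP : measurable_fun setT (pos Psi) by have [] := causal_pos cPsi.
pose f (z : R * R) : \bar R :=
  (frac_kernel (b + 1) (z.1 - s - z.2) * pos Psi z.2 * v z.1)%:E.
have mf : measurable_fun setT f.
  apply/measurable_EFinP; apply: measurable_funM; last exact: measurableT_comp.
  apply: measurable_funM; last exact: measurableT_comp.
  apply: measurableT_comp; first exact: measurable_frac_kernel.
  by apply: measurable_funB => //; exact: measurable_funB.
have iR t := RL_integrable (t - s) b10 (causal_pos cPsi).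
(* Absolute integrability: integrating [|f|] over [r] first gives a Riemann-Liouville integral of
   [|Psi|], which is continuous, times a function of compact support. *)
pose aPsi x := `|Psi x|.
have caPsi : continuous aPsi.
  by move=> x; apply: (@continuous_comp _ _ _ Psi); [exact: cPsi|exact: norm_continuous].
have iaR t := RL_integrable (t - s) b10 (causal_pos caPsi).
have posN r : `|pos Psi r| = pos aPsi r by rewrite /pos; case: ifP => // _; rewrite normr0.
have intF : (mu \x mu)%E.-integrable setT f.
  apply/integrable12ltyP => //.
  have -> : (\int[mu]_x \int[mu]_y `|f (x, y)| =
      \int[mu]_x `|(RLint (b + 1) (pos aPsi) (x - s) * v x)%:E|)%E.
    apply: eq_integral => t _; rewrite /f/=.
    under eq_integral do rewrite normrM
      (normrM (frac_kernel _ _)) posN (ger0_norm (frac_kernel_ge0 _ b10)) EFinM.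
    rewrite integralZr//; last exact: iaR.
    have R0 : 0 <= RLint (b + 1) (pos aPsi) (t - s).
      apply: Rintegral_ge0 => r _; rewrite mulr_ge0 ?frac_kernel_ge0//.
      by rewrite /pos; case: ifP => // _; exact: normr_ge0.
    rewrite (normrM (RLint _ _ _)) (ger0_norm R0) EFinM; congr (_ * _)%E.
    by rewrite /RLint /Rintegral fineK//; exact: (integrable_fin_num _ (iaR t)).
  have cF : continuous (fun x => RLint (b + 1) (pos aPsi) (x - s) * v x).
    move=> x; apply: cvgM; last exact: cv.
    by apply: (continuous_shift (RLint_pos_continuous b10 caPsi)).
  have : mu.-integrable setT (EFin \o (fun x => RLint (b + 1) (pos aPsi) (x - s) * v x)).
    by apply: (@integrable_support _ _ K) => // x /vK ->; rewrite mulr0.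
  by case/integrableP.
have corrE r : correlation g v r = \int[mu]_t (g (t - r) * v t).
  rewrite -[RHS](@Rintegral_shift _ _ r).
    by apply: eq_Rintegral => t _; rewrite addrK addrC.
  apply: measurable_funM => //; apply: continuous_measurable_fun.
  exact: continuous_shift.
have ig r : mu.-integrable setT (EFin \o (fun t => g (t - r) * v t)).
  apply: (@integrable_support _ _ K) => [t|x /vK ->]; last by rewrite mulr0.
  by apply: cvgM; [apply: (continuous_shift cg)|exact: cv].
have mT : measurable [set: R] by exact: measurableT.
have := congr1 fine (Fubini intF) => e.
transitivity (fine (\int[mu]_y \int[mu]_x f (x, y))%E).
  congr fine; apply: eq_integral => r _; rewrite corrE.
  rewrite -(Rintegral_realZ _ mT (ig r)) /Rintegral fineK; last first.
    by apply: integrable_fin_num => //; exact: (integrable_realZ _ mT (ig r)).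
  apply: eq_integral => t _; rewrite /f/= /g; congr (_%:E).
  have -> : t - r - s = t - s - r by ring.
  by rewrite mulrA (mulrC (pos Psi r)).
rewrite -e; congr fine; apply: eq_integral => t _; rewrite /f/=.
rewrite mulrC -(Rintegral_realZ _ mT (iR t)) /Rintegral fineK; last first.
  by apply: integrable_fin_num => //; exact: (integrable_realZ _ mT (iR t)).
by apply: eq_integral => r _; rewrite mulrC.
Qed.

Lemma history_pairing_correlation u : rtest u ->
  history_pairing tau Psi (correlation g u) = \int[mu]_t (c t * u t).
Proof.
move=> tu; rewrite (history_pairing_half_line tu) (fubini_pairing tu).
have [su [K uK]] := tu; have su' := rsmooth_derive su; have [_ [K' uK']] := rtest_derive tu.
pose L := Num.max 0 (Num.max K K') + 1.
have [L0 KL KL'] : [/\ 0 < L, K < L & K' < L].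
  by split; rewrite /L ltr_pwDr// !le_max lexx ?orbT.
have -> : \int[mu]_t (C t * u^`()%classic t) = \int[mu]_(t in `[- L, L]) (C t * u^`()%classic t).
  by apply: Rintegral_support => x Lx; rewrite (uK' x (lt_trans KL' Lx)) mulr0.
have -> : \int[mu]_t (c t * u t) = \int[mu]_(t in `[- L, L]) (c t * u t).
  by apply: Rintegral_support => x Lx; rewrite (uK x (lt_trans KL Lx)) mulr0.
have LL : - L < L by rewrite (lt_trans _ L0)// oppr_lt0.
have LRc (F F' : R -> R) : (forall x, is_derive x 1 F (F' x)) ->
    derivable_oo_LRcontinuous F (- L) L /\ {in `](- L), L[, F^`()%classic =1 F'}.
  move=> dF; have cF := is_derive_continuous dF.
  split; last by move=> x _; rewrite derive1E; have [_ ->] := dF x.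
  split=> [x _| |]; first by have [] := dF x.
    by apply: cvg_at_right_filter; exact: cF.
  by apply: cvg_at_left_filter; exact: cF.
have [C1 C2] := LRc _ _ is_derive_C.
have [u1 u2] := LRc _ _ (fun x => rsmooth_is_derive x su).
rewrite (Rintegration_by_parts LL (continuous_subspaceT cc) C1 C2
  (continuous_subspaceT (rsmooth_continuous su')) u1 u2).
have uL : u L = 0 by apply: uK; rewrite gtr0_norm.
have uNL : u (- L) = 0 by apply: uK; rewrite normrN gtr0_norm.
rewrite uL uNL; move: (C L) (C (- L)) (Rintegral _ _ _) => x y I.
by rewrite !mulr0 subrr sub0r opprK.
Qed.

End PairingConvolution.

(** * Extension of the data and test functions witnessing the convolution *)

Section ConvolutionWitness.
Context {R : realType}.
Local Notation mu := (@lebesgue_measure R).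
Implicit Types (u v : R -> R) (x t : R).

(** Turns continuity within an interval into continuity on the line; below, [rho] is a clamp onto
    the interval. *)
Lemma continuous_retract (A : set R) (rho f : R -> R) : {within A, continuous f} ->
  continuous rho -> (forall x, A (rho x)) -> continuous (fun x => f (rho x)).
Proof.
move=> cf crho Arho x P /= fP.
have /subspace_continuousP/(_ _ (Arho x)) := cf.
move=> /(_ P fP) /= h.
have hx : nbhs x (fun z => A (rho z) -> P (f (rho z))) := crho x _ h.
rewrite -[nbhs _ _]/(nbhs x (fun z => P (f (rho z)))).
by apply: filterS hx => z /(_ (Arho z)).
Qed.

Lemma continuous_clamp (a b : R) : continuous (fun x : R => Num.max a (Num.min x b)).
Proof.
move=> x; apply: (@continuous_max _ _ (fun=> a) (fun x => Num.min x b)); first exact: cvg_cst.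
by apply: (@continuous_min _ _ id (fun=> b)); [exact: cvg_id|exact: cvg_cst].
Qed.

(** The support of the correlation is bounded on the right only; the cutoff removes a part on the
    left that a distribution supported in [[0, +oo[] does not see. *)
Lemma rtest_cutoff_correlation g u : continuous g -> (forall x, x < 0 -> g x = 0) ->
  rtest u -> rtest (fun x => cutoff x * correlation g u x).
Proof.
move=> cg g0 tu; have [su [K uK]] := tu; split.
  exact: (rsmoothM (@cutoff_smooth R) (correlation_smooth cg tu)).
exists (Num.max K 1) => x; rewrite gt_max => /andP[xK x1].
have [x0|x0] := leP 0 x.
  rewrite ger0_norm// in xK.
  by rewrite (correlation_vanish g0 uK xK) mulr0.
by rewrite ltr0_norm// in x1; rewrite cutoff_le ?mul0r//; lra.
Qed.

Lemma history_pairing_cutoff tau Psi u : 0 < tau ->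
  history_pairing tau Psi (fun x => cutoff x * u x) = history_pairing tau Psi u.
Proof.
move=> tau0; have eqD x : `](- 2^-1 : R), +oo[%classic x -> cutoff x * u x = u x.
  by rewrite /= in_itv/= andbT => /ltW h; rewrite (cutoff_ge h) mul1r.
have D0 x : 0 <= x -> `](- 2^-1 : R), +oo[%classic x.
  by move=> x0; rewrite /= in_itv/= andbT (lt_le_trans _ x0)// oppr_lt0 invr_gt0.
have oD : open (`](- 2^-1 : R), +oo[%classic) by exact: interval_open.
have dE r : 0 <= r -> (fun x => cutoff x * u x)^`()%classic r = u^`()%classic r.
  by move=> r0; have := derive1n_local 1 oD eqD (D0 r r0).
rewrite /history_pairing (eqD _ (D0 _ (ltW tau0))).
rewrite (@eq_Rintegral _ _ _ mu _ (fun r => Psi r * u^`()%classic r))//.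
by move=> r; rewrite inE/= in_itv/= => /andP[r0 _]; rewrite (dE r r0).
Qed.

Lemma rtest_complex_test u v : rtest u -> rtest v ->
  test_function (fun x => u x +i* v x).
Proof.
move=> [su [K uK]] [sv [K' vK]]; split.
  by move=> n x; split; [exact: su|exact: sv].
exists (Num.max K K') => x; rewrite gt_max => /andP[xK xK'].
by rewrite (uK x xK) (vK x xK').
Qed.

End ConvolutionWitness.

Theorem proposition5 (R : realType) (alpha tau : R) (lambda : R[i])
    (f phi : R -> R) (y : R -> R[i]) (p : (R -> R[i]) -> R[i]) :
  0 < alpha -> alpha < 1 -> 0 < tau ->
  {within `[0, +oo[, continuous f} ->
  {within `[- tau, 0], continuous phi} ->
  delay_solution alpha tau lambda f phi y ->
  inverse_laplace_transform
    (fun s : R[i] => cexp (- s * tau%:C) * P_tau tau phi s) p ->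
  exists c : nat -> R -> R[i],
    (forall k : nat,
       continuous_convolution p (delayed_power alpha tau k) (c k)) /\
    (forall t : R, 0 <= t ->
       y t = (phi 0)%:C
             + \sum_(0 <= k < (Num.truncn (t / tau)).+1)
                 lambda ^+ k.+1 * c k t
             + generalized_integral alpha tau lambda f t).
Proof.
move=> alpha0 _ tau0 cf cphi sol lap.
(* Clamping extends the data continuously to the line without changing them where the equation uses
   them. *)
pose Psi r := phi (Num.max (- tau) (Num.min (r - tau) 0)).
pose F r := f (Num.max 0 r).
have cPsi : continuous Psi.
  apply: (@continuous_retract R _ (fun r => Num.max (- tau) (Num.min (r - tau) 0)) _ cphi).
    exact: continuous_shift (@continuous_clamp R (- tau) 0).
  by move=> r; rewrite /= in_itv/= le_max lexx/= ge_max oppr_le0 (ltW tau0) ge_min lexx orbT.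
have cF : continuous F.
  apply: (@continuous_retract R _ (fun r => Num.max 0 r) _ cf).
    by move=> r; apply: (@continuous_max _ _ (fun=> 0) id); [exact: cvg_cst|exact: cvg_id].
  by move=> r; rewrite /= in_itv/= andbT le_max lexx.
have FE r : 0 <= r -> F r = f r by move=> r0; rewrite /F max_r.
have PsiM r : 0 <= r -> Psi r = phi (Num.min (r - tau) 0).
  move=> r0; rewrite /Psi max_r// le_min lerBrDr addNr r0.
  by rewrite oppr_le0 ltW.
have PsiE r : - tau <= r <= 0 -> Psi (r + tau) = phi r.
  move=> /andP[r1 r0]; rewrite PsiM; last by rewrite -lerBlDr sub0r.
  by rewrite addrK min_l.
have PsiC r : tau <= r -> Psi r = Psi tau.
  move=> tr; rewrite !PsiM ?(ltW tau0)//; last exact: le_trans (ltW tau0) tr.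
  by rewrite subrr minxx min_r// subr_ge0.
exists (fun k t => (delayed_RLint alpha tau k Psi t)%:C); split.
  move=> k; pose s := k%:R * tau; pose b := k.+1%:R * alpha.
  have s0 : 0 <= s by rewrite mulr_ge0// ltW.
  have b0 : 0 < b by rewrite mulr_gt0.
  pose g t := frac_kernel (b + 1) (t - s).
  have gE : delayed_power alpha tau k = g.
    by apply/funext => t; exact: delayed_powerE.
  have cg : continuous g.
    apply: (@continuous_shift R _ (frac_kernel (b + 1))) => t.
    by apply: cvgM; [exact: tpow_continuous|exact: cvg_cst].
  have g0 t : t < 0 -> g t = 0.
    by move=> t0; apply: frac_kernel_le0; rewrite subr_le0 (le_trans (ltW t0)).
  have pE u : rtest u ->
      p (fun x => (cutoff x * correlation g u x)%:C) =
      (\int[lebesgue_measure]_t (delayed_RLint alpha tau k Psi t * u t))%:C.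
    move=> tu.
    rewrite (inverse_laplace_unique tau0 cPsi PsiE lap
      (rtest_cutoff_correlation cg g0 tu)).
    by rewrite (history_pairing_cutoff _ _ tau0)
      (history_pairing_correlation tau0 b0 s0 cPsi PsiC tu).
  split.
    split; apply: continuous_subspaceT => t /=; last exact: cvg_cst.
    have cA : continuous (delayed_RLint alpha tau k Psi).
      exact: delayed_RLint_continuous.
    exact: cA.
  move=> psi tpsi; have [tr ti] := test_parts tpsi.
  have tcr := rtest_cutoff_correlation cg g0 tr.
  have tci := rtest_cutoff_correlation cg g0 ti.
  (* Equal to the inner integral on []-1/2, +oo[], where the cutoff is 1. *)
  exists (fun x => (cutoff x * correlation g (fun x => complex.Re (psi x)) x) +i*
                   (cutoff x * correlation g (fun x => complex.Im (psi x)) x)); split.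
  - exact: (rtest_complex_test tcr tci).
  - exists 2^-1 => [|x x2]; first by rewrite invr_gt0.
    rewrite gE /cintegral (cutoff_ge (ltW x2)) !mul1r; apply: complexP => /=.
      by apply: eq_Rintegral => r _; rewrite ReMrc.
    by apply: eq_Rintegral => r _; rewrite ImMrc.
  have [[lin _] _ _] := lap.
  (* Written as ['i] times a real test function plus another, to apply linearity of [p] and then
     [pE] to each part. *)
  rewrite (_ : (fun x => _) = fun x =>
     'i * (cutoff x * correlation g (fun x => complex.Im (psi x)) x)%:C +
     (cutoff x * correlation g (fun x => complex.Re (psi x)) x)%:C); last first.
    apply/funext => x.
    by rewrite -[LHS]complex_recompose.
  rewrite (lin _ _ _ (rtest_test tci) (rtest_test tcr)) (pE _ tr) (pE _ ti).
  rewrite -[RHS]complex_recompose /cintegral /=.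
  congr ('i * _%:C + _%:C); apply: eq_Rintegral => r _; first by rewrite ImMrc.
  by rewrite ReMrc.
move=> t t0; set N := (Num.truncn (t / tau)).+1.
(* The successor in [N] makes the inequality strict, including when [t] is a multiple of [tau]. *)
have tN : 0 <= t < N%:R * tau.
  by rewrite t0 -ltr_pdivrMr//; exact: truncnS_gt.
rewrite (delay_solution_steps alpha0 tau0 cPsi cF PsiM FE sol tN) big_split/= addrA.
congr (_ + _); rewrite /generalized_integral -/N; apply: eq_bigr => k _.
have b0 : 0 < k.+1%:R * alpha by rewrite mulr_gt0.
have [_ _ e] := frac_integrable_real (t - k%:R * tau) b0 cF.
rewrite /delayed_RLint -e; congr (_ * _).
have -> : alpha * k%:R + alpha = k.+1%:R * alpha by rewrite -natr1; ring.
by apply: eq_frac_integral => r /andP[r0 _]; rewrite FE.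
Qed.
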